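(* Let $\mathbb{F}_q$ be the finite field with $q$ elements, $d\ge 2$, $t\in\mathbb{F}_q$ with $t\neq 0$, and $E\subseteq \mathbb{F}_q^d$. Let $$\gamma=\begin{cases}-1 & d=2,\\ -\frac{d-2}{2} & d\ge 3.\end{cases}$$ Let $n\ge 4$ be an integer and suppose $$12q^{\gamma}+8\frac{q^{d+2}}{|E|^2}+\left(24+12\left\lfloor \frac{n}{2}\right\rfloor\right)\frac{q^{\frac{d+1}{2}}}{|E|}\le 1 .$$ Then: if $n\ge 6$, $$\left|C_n^{dist}-\frac{|E|^n}{q^n}\right|\le \frac{|E|^n}{q^n}\left(12q^{\gamma}+8\frac{q^{d+1}}{|E|^2}+\left(24+12\left\lfloor \frac{n}{2}\right\rfloor\right)\frac{q^{\frac{d+1}{2}}}{|E|}\right);$$ moreover, $$\left|C_4^{dist}-\frac{|E|^4}{q^4}\right|\le \frac{|E|^4}{q^4}\left(12q^{\gamma}+8\frac{q^{d+2}}{|E|^2}+28\frac{q^{\frac{d+1}{2}}}{|E|}\right),\qquad \left|C_5^{dist}-\frac{|E|^5}{q^5}\right|\le \frac{|E|^5}{q^5}\left(12q^{\gamma}+8\frac{q^{\frac{2d+3}{2}}}{|E|^2}+32\frac{q^{\frac{d+1}{2}}}{|E|}\right).$$ The same statements hold with $C_n^{dist}$ replaced by $C_n^{prod}$ (for all the values of $n$ above).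
   Context: For $x\in\mathbb{F}_q^d$, $\|x\|=x_1^2+\dots+x_d^2$ and $x\cdot y=x_1y_1+\dots+x_dy_d$. The distance graph $\mathcal{G}^{dist}_t(E)$ has vertex set $E$, with $x,y$ adjacent iff $\|x-y\|=t$; the dot-product graph $\mathcal{G}^{prod}_t(E)$ has vertex set $E$, with $x,y$ adjacent iff $x\cdot y=t$. $C_n^{dist}$ is the number of $n$-tuples $(x_1,\dots,x_n)\in E^n$ with $\|x_1-x_2\|=\|x_2-x_3\|=\dots=\|x_{n-1}-x_n\|=\|x_n-x_1\|=t$ (cycles of length $n$, vertices not required distinct); $C_n^{prod}$ is defined the same way with $x_i\cdot x_{i+1}=t$ and $x_n\cdot x_1=t$.
   Formalization: The distance-graph estimates are proved only for odd q; for even q there are no 5-cycles in the distance graph when t is nonzero, so the C_5 estimate as printed is false (e.g. d=3, q=2^10, E the whole space). The dot-product estimates hold for all q. *)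

(* Defs.v *)
From HB Require Import structures.
From mathcomp Require Import all_boot all_order all_algebra.
From mathcomp Require Import reals exp.

Set Implicit Arguments.
Unset Strict Implicit.
Unset Printing Implicit Defensive.

Import Order.TTheory GRing.Theory Num.Theory.

Local Open Scope ring_scope.

Section Graphs.

Variables (F : finFieldType) (d : nat).
Implicit Types (x y : 'rV[F]_d) (t : F) (E : {set 'rV[F]_d}).

(* Not a norm: a quadratic form with values in F. In characteristic 2 it is the
   square of the linear form x |-> \sum_i x 0 i, the distance graph on all of
   F^d then has no odd cycle for t != 0, and the estimates below fail for it;
   this is why the distance case is stated for #|F| odd. *)
Definition sqnorm x : F := \sum_(i < d) x 0 i ^+ 2.

Definition dotprod x y : F := \sum_(i < d) x 0 i * y 0 i.

Definition dist_adj t : rel 'rV[F]_d := fun x y => sqnorm (x - y) == t.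

Definition prod_adj t : rel 'rV[F]_d := fun x y => dotprod x y == t.

(* [cycle e [:: x_1; ...; x_n]] unfolds to
   e x_1 x_2 && ... && e x_(n-1) x_n && e x_n x_1, so closed walks with
   repeated vertices are counted, as are all rotations and reflections. *)
Definition num_cycles (e : rel 'rV[F]_d) E (n : nat) : nat :=
  #|[set c : n.-tuple 'rV[F]_d | all (mem E) c && cycle e c]|.

End Graphs.

Section Estimates.

Variable R : realType.

Definition gamma_exponent (d : nat) : R :=
  if d == 2%N then - 1 else - ((d%:R - 2) / 2).

(* In the definitions below q is the order of the field, N the cardinality of
   the vertex set, and C k the number of cycles of length k. When N = 0 the
   quotients by N are 0 by convention; then C k = 0 for k > 0 and both sides
   of every estimate vanish. *)
Definition cycle_hypothesis (q N : R) (d n : nat) : Prop :=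
  12 * q `^ gamma_exponent d + 8 * (q ^+ (d + 2) / N ^+ 2)
    + (24 + 12 * n./2)%:R * (q `^ ((d%:R + 1) / 2) / N) <= 1.

Definition cycle_estimates (q N : R) (d n : nat) (C : nat -> nat) : Prop :=
  [/\ (6 <= n)%N ->
        `|(C n)%:R - N ^+ n / q ^+ n| <=
          N ^+ n / q ^+ n *
          (12 * q `^ gamma_exponent d + 8 * (q ^+ (d + 1) / N ^+ 2)
             + (24 + 12 * n./2)%:R * (q `^ ((d%:R + 1) / 2) / N)),
      `|(C 4%N)%:R - N ^+ 4 / q ^+ 4| <=
        N ^+ 4 / q ^+ 4 *
        (12 * q `^ gamma_exponent d + 8 * (q ^+ (d + 2) / N ^+ 2)
           + 28 * (q `^ ((d%:R + 1) / 2) / N))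
    & `|(C 5%N)%:R - N ^+ 5 / q ^+ 5| <=
        N ^+ 5 / q ^+ 5 *
        (12 * q `^ gamma_exponent d + 8 * (q `^ ((2 * d%:R + 3) / 2) / N ^+ 2)
           + 32 * (q `^ ((d%:R + 1) / 2) / N))].

End Estimates.

(* Main.v *)
Require Import Defs.
From HB Require Import structures.
From mathcomp Require Import all_boot all_order all_algebra all_field.
From mathcomp Require Import reals exp.
From mathcomp Require Import complex.
From mathcomp Require Import ring lra zify.

(** Write the adjacency matrix restricted to E as M = J/q + B, J the all-ones
    matrix. If B has operator norm at most lam = 2 q^((d-1)/2), then replacing
    the factors of M^n by J/q one at a time and using
    |tr B^n| <= lam^(n-2) tr B^2 gives, with L = |E|/q,
      |tr M^n - L^n| <= (L + lam)^n - L^n + lam^(n-2) |E| (L + lam),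
    which implies all the estimates.

    For the dot-product graph the norm bound is a Plancherel computation. The
    distance graph is a Cayley graph, and its eigenvalues are q^(d/2-1) times a
    Salie sum (d odd), which is evaluated explicitly, or a Kloosterman sum K
    (d even), for which Weil's bound |K| <= 2 sqrt q is required. Along a tower
    of quadratic extensions K becomes 2q - K^2, so if K^2 > 4q then K^2/q tends
    to infinity along the tower. This contradicts |K| = O(sqrt q) with a constant
    that is uniform over the tower, which follows from Stepanov's method in
    Bombieri's form on the curve y^q0 - y = x + b/x - c, q0 the order of the
    bottom field. *)

Set Implicit Arguments.
Unset Strict Implicit.
Unset Printing Implicit Defensive.

Import Order.TTheory GRing.Theory Num.Theory.

Local Open Scope ring_scope.

(** * Additive characters *)

(** The passage from K to 2q - K^2 is the degree 2 case of the Hasse-Davenport relation. It is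
    proved by counting: K^2 and the sum over the extension consist of the same terms, indexed by x
    and n != 0, with multiplicities the numbers of square roots of x^2 - n and of v (x^2 - n), v a
    fixed nonsquare. These multiplicities add up to 2, and orthogonality evaluates the total. The
    curve keeps the exponent q0 because characters lifted by traces stay invariant under z -> z^q0,
    so psi (y^q0 - y) = 1 on every floor. The Stepanov error is about 2 q0^2 r on a floor of order
    r^2; an exponent growing with the floor would spoil the factor in front of r. Stepanov's method
    bounds numbers of points from above only. Varying c supplies the rest: the curves for all c
    partition the pairs (x, y) with x != 0, so upper bounds for every c control the total deviation.
    The trace of B^n is kept apart because tr B^2 is a sum of squares of entries, which the number
    of edges controls as M has entries 0 and 1. *)

Definition additive_character (F : finFieldType) (C : numClosedFieldType)
    (psi : F -> C) : Prop :=
  [/\ psi 0 = 1, forall x y, psi (x + y) = psi x * psi y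
    & exists a, psi a != 1].

Lemma exists_nontrivial_root_of_unity (C : numClosedFieldType) p : prime p ->
  exists2 w : C, w ^+ p = 1 & w != 1.
Proof.
move=> p_pr; have p_gt1 := prime_gt1 p_pr.
pose P : {poly C} := \sum_(i < p) 'X^i.
have szP : size P = p.
  have -> : P = \poly_(i < p) 1 by rewrite poly_def; apply: eq_bigr => i _; rewrite scale1r.
  by apply: size_poly_eq; exact: oner_neq0.
have [w] := closed_rootP P (eq_ind_r (fun n => n != 1%N) (negbT (gtn_eqF p_gt1)) szP).
rewrite rootE horner_sum => /eqP w0.
have wE : \sum_(i < p) w ^+ i = 0 by rewrite -[RHS]w0; apply: eq_bigr => i _; rewrite hornerXn.
exists w.
  by apply/eqP; rewrite -subr_eq0 subrX1 wE mulr0.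
apply: contra_eq_neq wE => ->.
under eq_bigr do rewrite expr1n.
by rewrite sumr_const card_ord pnatr_eq0 -lt0n ltnW.
Qed.

(** Over the prime field, a coordinate form of F is additive; a p-th root of unity raised to it is a
    character, nontrivial at the corresponding basis vector. *)
Lemma exists_additive_character (F : finFieldType) (C : numClosedFieldType) :
  exists psi : F -> C, additive_character psi.
Proof.
have [p p_pr pF] := finPcharP F; have p_gt1 := prime_gt1 p_pr.
have [w wp w1] := exists_nontrivial_root_of_unity C p_pr.
pose V := pPrimeCharType pF; pose U : {vspace V} := fullv.
have dimU : (0 < \dim U)%N.
  rewrite lt0n dimv_eq0 -subv0; apply/subvPn; exists (1 : V); rewrite ?memvf //.
  by rewrite memv0 oner_eq0.
pose l (x : F) : 'F_p := coord (vbasis U) (Ordinal dimU) (x : V).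
have lD x y : l (x + y) = l x + l y by apply: (raddfD (coord (vbasis U) (Ordinal dimU))).
(* Addition in ['F_p] reduces modulo [(Zp_trunc (pdiv p)).+2], which equals p only by [Fp_cast]. *)
have wmod n : w ^+ (n %% (Zp_trunc (pdiv p)).+2) = w ^+ n.
  by rewrite Fp_cast // [in RHS](divn_eq n p) exprD mulnC exprM wp expr1n mul1r.
exists (fun x => w ^+ l x); split.
- have -> : l 0 = 0 by apply: (raddf0 (coord (vbasis U) (Ordinal dimU))).
  by rewrite expr0.
- by move=> x y; rewrite lD /= -exprD wmod.
exists ((vbasis U)`_0 : V).
have -> : l (vbasis U)`_0 = 1.
  by rewrite /l (coord_free (Ordinal dimU) (Ordinal dimU)) ?eqxx // (basis_free (vbasisP U)).
by rewrite /= wmod expr1.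
Qed.

Section AdditiveCharacter.

Variables (F : finFieldType) (C : numClosedFieldType) (psi : F -> C).
Hypothesis psiP : additive_character psi.

Let psi0 : psi 0 = 1. Proof. by case: psiP. Qed.
Let psiD x y : psi (x + y) = psi x * psi y. Proof. by case: psiP. Qed.

Lemma norm_character x : `|psi x| = 1.
Proof.
have [p p_pr pF] := finPcharP F; have p_gt0 := prime_gt0 p_pr.
have psiX n : psi (x *+ n) = psi x ^+ n.
  by elim: n => [|n IHn]; rewrite ?mulr0n ?psi0 // mulrS psiD IHn exprS.
have := psiX p; rewrite (mulrn_pchar pF) psi0 => /(congr1 Num.norm).
by rewrite normrX normr1 => /esym/eqP; rewrite pexpr_eq1 // => /eqP.
Qed.

Lemma conj_character x : (psi x)^* = psi (- x).
Proof.
have nz : psi x != 0 by rewrite -normr_eq0 norm_character oner_eq0.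
apply: (mulfI nz); rewrite -psiD subrr psi0.
by rewrite -normCK norm_character expr1n.
Qed.

Lemma sum_character : \sum_x psi x = 0.
Proof.
have [_ _ [a a1]] := psiP; apply/eqP.
have: psi a * \sum_x psi x = \sum_x psi x.
  rewrite mulr_sumr [RHS](reindex (+%R a)) /=; first by apply: eq_bigr.
  by apply: onW_bij; exists (fun x => - a + x) => x; rewrite ?addKr ?addNKr.
move/eqP; rewrite -subr_eq0 -{2}[\sum_x _]mul1r -mulrBl mulf_eq0 subr_eq0.
by rewrite (negPf a1).
Qed.

Lemma sum_characterM a : \sum_x psi (a * x) = (if a == 0 then #|F|%:R else 0).
Proof.
have [->|a0] := eqVneq a 0.
  under eq_bigr do rewrite mul0r psi0.
  by rewrite sumr_const.
rewrite -[RHS]sum_character [RHS](reindex (fun x => a * x)) //=.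
by apply: onW_bij; exists (fun x => a^-1 * x) => x; rewrite ?mulKf ?mulVKf.
Qed.

Definition kloosterman b : C := \sum_(x | x != 0) psi (x + b / x).

Lemma kloosterman_real b : (kloosterman b)^* = kloosterman b.
Proof.
rewrite /kloosterman rmorph_sum (reindex_inj oppr_inj) /=.
by apply: eq_big => x; rewrite ?oppr_eq0 // conj_character invrN mulrN opprD !opprK.
Qed.

End AdditiveCharacter.

(** * Stepanov's method on an Artin-Schreier curve *)

(** Modulo q the sum is y. On the curve below this says that monomials of degree less than q in v
    have distinct pole orders at infinity. *)
Lemma weight_exponent_inj q x y x' y' : (y < q)%N -> (y' < q)%N ->
  (q * x + q.+1 * y = q * x' + q.+1 * y')%N -> x = x' /\ y = y'.
Proof.
move=> lty lty' E; have yE : y = y'.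
  have := congr1 (modn^~ q) E.
  rewrite !mulSn !(addnCA (q * _)) ![(_ + (q * _ + _))%N]addnC -!mulnDr.
  by rewrite ![(q * _)%N]mulnC !modnMDl !modn_small.
split=> //; move: E; rewrite yE => /addIn/eqP; rewrite eqn_mul2l.
by case/orP=> [/eqP q0|/eqP//]; rewrite q0 ltn0 in lty.
Qed.

(** * Pole orders and reduction on the curve *)

Section PlaneCurve.

Import Pdiv.CommonRing Pdiv.RingMonic.

Variables (L : fieldType) (q : nat) (b c : L).
Hypothesis q_gt1 : (1 < q)%N.

(** Multiplying by x^q clears the denominator of b / x; the unknown v = x y then satisfies a monic
    equation over the polynomials in x. *)
Definition curve_rhs : {poly L} := 'X^(q.+1) + b *: 'X^(q.-1) - c *: 'X^q.

(* With outer variable v and inner variable x, this is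
   v^q - x^(q-1) v - (x^(q+1) + b x^(q-1) - c x^q), the equation satisfied by
   v = x y on the curve y^q - y = x + b / x - c. *)
Definition curve : {poly {poly L}} :=
  'X^q - ('X^(q.-1) *: 'X + curve_rhs%:P).

Definition reduce (p : {poly {poly L}}) := rmodp p curve.

(* x and v have a pole of order q and q+1 respectively at infinity; the
   exponents of [weight p] are the pole orders of the monomials of [p]. *)
Definition weight (p : {poly {poly L}}) : {poly L} :=
  (map_poly (comp_poly 'X^q) p).['X^(q.+1)].

Definition monomial i j : {poly {poly L}} := 'X^i *: 'X^j.

Lemma size_curve_tail : (size ('X^(q.-1) *: 'X + curve_rhs%:P)%R <= q)%N.
Proof.
apply: leq_trans (size_polyD _ _) _; rewrite geq_max; apply/andP; split.
  by apply: leq_trans (size_scale_leq _ _) _; rewrite size_polyX.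
by apply: leq_trans (size_polyC_leq1 _) _; apply: ltnW.
Qed.

Lemma size_curve : size curve = q.+1.
Proof.
by rewrite size_polyDl size_polyXn // size_polyN ltnS size_curve_tail.
Qed.

Lemma curve_monic : curve \is monic.
Proof.
rewrite monicE lead_coefDl ?lead_coefXn //.
by rewrite size_polyXn size_polyN ltnS size_curve_tail.
Qed.

Lemma size_reduce p : (size (reduce p) <= q)%N.
Proof. by rewrite -ltnS -size_curve ltn_rmodpN0 // -size_poly_gt0 size_curve. Qed.

Lemma weightD : {morph weight : p r / p + r}.
Proof. by move=> p r; rewrite /weight rmorphD hornerD. Qed.

Lemma weight0 : weight 0 = 0.
Proof. by rewrite /weight rmorph0 horner0. Qed.

Lemma weightZ (k : {poly L}) p : weight (k *: p) = (k \Po 'X^q) * weight p.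
Proof. by rewrite /weight map_polyZ hornerZ. Qed.

Lemma weight_monomial i j : weight (monomial i j) = 'X^(q * i + q.+1 * j).
Proof.
by rewrite weightZ /weight map_polyXn hornerXn comp_Xn_poly -!exprM exprD.
Qed.

(** Nothing cancels, by [weight_exponent_inj]. Hence a reduced polynomial of weight 0 is itself 0,
    so that vanishing on the curve becomes a system of linear equations over the constants. *)
Lemma coef_weight (p : {poly {poly L}}) k j : (size p <= q)%N -> (j < q)%N ->
  (weight p)`_(q * k + q.+1 * j) = p`_j`_k.
Proof.
move=> szp ltjq.
have szm : (size (map_poly (comp_poly 'X^q) p) <= q)%N.
  exact: leq_trans (size_poly _ _) szp.
rewrite /weight (horner_coef_wide _ szm) coef_sum (bigD1 (Ordinal ltjq)) //=.
rewrite coef_map /= -exprM coefMXn ltnNge leq_addl /= addnK.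
rewrite coef_comp_poly_Xn ?(ltnW q_gt1) // dvdn_mulr // mulKn ?(ltnW q_gt1) //.
rewrite big1 ?addr0 // => i; rewrite -val_eqE /= => neij.
rewrite coef_map /= -exprM coefMXn; case: ifP => // /negbT; rewrite -leqNgt => le.
rewrite coef_comp_poly_Xn ?(ltnW q_gt1) //; case: ifP => // /dvdnP[z zE].
case/negP: neij; apply/eqP.
have E : (q * k + q.+1 * j = q * z + q.+1 * i)%N by rewrite (mulnC q z) -zE subnK.
by have [_ ->] := weight_exponent_inj ltjq (ltn_ord i) E.
Qed.

Lemma reduce_monomial_small i j : (j < q)%N ->
  reduce (monomial i j) = monomial i j.
Proof.
move=> ltjq; rewrite /reduce rmodp_small // size_curve ltnS.
by apply: leq_trans (size_scale_leq _ _) _; rewrite size_polyXn.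
Qed.

Lemma reduceD : {morph reduce : p r / p + r}.
Proof. by move=> p r; rewrite /reduce rmodpD ?curve_monic. Qed.

Lemma reduceZ (k : {poly L}) p : reduce (k *: p) = k *: reduce p.
Proof. by rewrite /reduce rmodpZ ?curve_monic. Qed.

Lemma reduce_monomial_step i j : (q <= j)%N ->
  reduce (monomial i j) =
    reduce (monomial (i + q.+1) (j - q))
    + (reduce (monomial (i + q.-1) (j - q).+1)
       + (b%:P *: reduce (monomial (i + q.-1) (j - q))
          + (- c)%:P *: reduce (monomial (i + q) (j - q)))).
Proof.
move=> leqj; rewrite -!reduceZ -!reduceD.
have -> : monomial i j = ('X^i *: 'X^(j - q)) * curve
  + (monomial (i + q.+1) (j - q) + (monomial (i + q.-1) (j - q).+1
       + (b%:P *: monomial (i + q.-1) (j - q)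
          + (- c)%:P *: monomial (i + q) (j - q)))).
  rewrite /monomial /curve /curve_rhs -!mul_polyC !exprD (exprS _ (j - q)).
  have -> : 'X^j = 'X^(j - q) * 'X^q :> {poly {poly L}} by rewrite -exprD subnK.
  rewrite !(rmorphD, rmorphB, rmorphM, rmorphN) /=; ring.
rewrite [LHS]reduceD (_ : reduce (_ * curve) = 0) ?add0r //.
by rewrite /reduce rmodp_mull ?curve_monic.
Qed.

(** Strong induction on j. One replacement of v^q gives a monomial of the same weight with
    coefficient 1, and three terms whose weights are smaller by q - 1, 2q and q. *)
Lemma weight_reduce_monomial i j :
  weight (reduce (monomial i j)) \is monic /\
  size (weight (reduce (monomial i j))) = (q * i + q.+1 * j).+1.
Proof.
elim/ltn_ind: j i => j IHj i; have [ltjq|leqj] := ltnP j q.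
  by rewrite reduce_monomial_small // weight_monomial monicXn size_polyXn.
rewrite reduce_monomial_step // !weightD !weightZ !comp_polyC.
have lt1 : (j - q < j)%N by rewrite ltn_subrL; lia.
have lt2 : ((j - q).+1 < j)%N by lia.
have [m1 s1] := IHj _ lt1 (i + q.+1)%N; have [_ s2] := IHj _ lt2 (i + q.-1)%N.
have [_ s3] := IHj _ lt1 (i + q.-1)%N; have [_ s4] := IHj _ lt1 (i + q)%N.
set w1 := weight _ in m1 s1 *; set w2 := weight _ in s2 *.
set w3 := weight _ in s3 *; set w4 := weight _ in s4 *.
have szr : (size (w2 + (b%:P * w3 + (- c)%:P * w4))%R < size w1)%N.
  rewrite s1 ltnS; apply: leq_trans (size_polyD _ _) _; rewrite geq_max s2.
  apply/andP; split; first nia.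
  apply: leq_trans (size_polyD _ _) _; rewrite !mul_polyC geq_max.
  apply/andP; split; apply: leq_trans (size_scale_leq _ _) _; rewrite ?s3 ?s4; nia.
rewrite monicE lead_coefDl // size_polyDl // s1; split; first exact: m1.
congr _.+1; nia.
Qed.

Lemma reduce_eval p (x v : L) :
  v ^+ q = x ^+ q.-1 * v + x ^+ q.+1 + b * x ^+ q.-1 - c * x ^+ q ->
  (reduce p).[v%:P].[x] = p.[v%:P].[x].
Proof.
move=> vE; have c0 : curve.[v%:P].[x] = 0.
  rewrite /curve /curve_rhs; do 9! rewrite ?(hornerD, hornerN, hornerZ, hornerC,
    hornerX, hornerXn, hornerM, horner_exp).
  by rewrite vE; ring.
have := congr1 (fun f : {poly {poly L}} => f.[v%:P].[x]) (rdivp_eq curve_monic p).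
by rewrite /= hornerD hornerM hornerD hornerM c0 mulr0 add0r => ->.
Qed.

End PlaneCurve.

(** * The auxiliary function and the number of covered points *)

Section Stepanov.

Import Pdiv.CommonRing Pdiv.RingMonic.

Variables (L : finFieldType) (q r : nat) (b c : L) (Z : {set L}).
Hypotheses (q_gt1 : (1 < q)%N) (ler : (q ^ 3 <= r)%N) (dvdqr : (q %| r)%N).
Hypotheses (qchar : [pchar L].-nat q) (rchar : [pchar L].-nat r).
Hypotheses (cardL : #|L| = (r ^ 2)%N).
Hypotheses (cardZ : #|Z| = q) (fixZ : forall a, a \in Z -> a ^+ q = a).

Definition covered : {set L} :=
  [set x | (x != 0) && [exists y, y ^+ q - y == x + b / x - c]].

(** [A] is the largest bound that keeps [wu] below r: the maximum of [wu] is q (A - 1) + (q + 1)(q -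
    1) = r - 1. [B] makes the pairs of monomials outnumber the linear conditions, see [card_I]. *)
Let A := (r %/ q - q).+1.
Let B := (r %/ q + q)%N.
Let I : finType := (('I_A * 'I_q) * ('I_B * 'I_q))%type.

Let wu (i : I) := (q * i.1.1 + q.+1 * i.1.2)%N.
Let ws (i : I) := (q * i.2.1 + q.+1 * i.2.2)%N.

Let r_eq : r = (q * (r %/ q))%N. Proof. by rewrite mulnC divnK. Qed.

Let q2_le : (q ^ 2 <= r %/ q)%N.
Proof. by rewrite leq_divRL ?(ltnW q_gt1) // -expnSr. Qed.

Let wu_lt i : (wu i < r)%N.
Proof.
case: i => [[[i lti] [j ltj]] s]; rewrite /wu /=.
move: lti; rewrite /A; move: (r %/ q)%N r_eq q2_le => r1 -> le lti.
have : (q * i + q * q <= q * r1)%N.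
  by rewrite -mulnDr leq_mul2l; move: le lti; rewrite -mulnn; nia.
have : (q.+1 * j.+1 <= q.+1 * q)%N by rewrite leq_mul2l ltj orbT.
by rewrite mulnS !mulSn; move: q_gt1; clear; lia.
Qed.

Let ws_le i : (ws i <= r + 2 * q ^ 2 - q - 1)%N.
Proof.
case: i => [u [[i lti] [j ltj]]]; rewrite /ws /=.
move: lti; rewrite /B; move: (r %/ q)%N r_eq q2_le => r1 -> le lti.
have : (q * i.+1 <= q * (r1 + q))%N by rewrite leq_mul2l lti orbT.
have : (q.+1 * j.+1 <= q.+1 * q)%N by rewrite leq_mul2l ltj orbT.
by rewrite -mulnn mulnDr !mulnS !mulSn; move: q_gt1; clear; lia.
Qed.

Let w_inj (i k : I) : (wu i + r * ws i = wu k + r * ws k)%N -> i = k.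
Proof.
move=> wE.
have wuE : wu i = wu k.
  have := congr1 (modn^~ r) wE.
  by rewrite ![(r * _)%N]mulnC ![(_ + _ * r)%N]addnC !modnMDl !modn_small.
have wsE : ws i = ws k.
  by move: wE; rewrite wuE => /addnI/eqP; rewrite eqn_mul2l => /orP[|/eqP//]; lia.
case: i k wuE wsE {wE} => [[i1 i2] [i3 i4]] [[k1 k2] [k3 k4]].
rewrite /wu /ws /=.
move=> /(weight_exponent_inj (ltn_ord _) (ltn_ord _))[/val_inj-> /val_inj->].
move=> /(weight_exponent_inj (ltn_ord _) (ltn_ord _))[/val_inj-> /val_inj->].
by [].
Qed.

Let dim := (r * (r - 1) + (r + 2 * q ^ 2 - q - 1))%N.

(** The index set has r^2 + q r - q^4 + q^3 elements and [dim.+1] is r^2 + 2 q^2 - q; since r >=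
    q^3, the difference is at least q (q - 1)^2 > 0. *)
Let card_I : (dim.+1 < #|{: I}|)%N.
Proof.
rewrite !card_prod !card_ord /dim /A /B.
move: (r %/ q)%N r_eq q2_le => r1 -> le.
have {le} -> : r1 = (r1 - q ^ 2 + q * q)%N by rewrite mulnn subnK.
move: (r1 - q ^ 2)%N => k; move: q_gt1; clear.
case: q => [|[|m]] // _; rewrite -mulnn.
have -> : (k + m.+2 * m.+2 - m.+2).+1 = (k + m.+2 * m.+1 + 1)%N.
  by rewrite (mulnSr m.+2 m.+1) addnA addnK addn1.
set s := (m.+2 * (k + m.+2 * m.+2))%N.
have -> : ((k + m.+2 * m.+1 + 1) * m.+2 * ((k + m.+2 * m.+2 + m.+2) * m.+2)
  = s * s + m.+2 * m.+2 * (k + m.+2))%N by rewrite /s; lia.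
have : (0 < s)%N by rewrite /s; lia.
move: s => [//|s] _; rewrite subn1 /=; nia.
Qed.

(* The index i stands for a pair (u, s) of monomials of weights [wu i] and
   [ws i]; [hm i] is u^r s and [gm i] is u s^r. Since z^(r^2) = z in L, at a
   rational point the r-th power of the sum of the D_i^r u_i s_i^r is the sum of
   the D_i u_i^r s_i, and D is chosen so that the latter reduces to 0. The
   weights of the [gm i] are distinct because [wu i < r], so the first sum does
   not reduce to 0. *)
Let hm (i : I) : {poly {poly L}} :=
  monomial L (i.1.1 * r + i.2.1) (i.1.2 * r + i.2.2).
Let gm (i : I) : {poly {poly L}} :=
  monomial L (i.1.1 + i.2.1 * r) (i.1.2 + i.2.2 * r).

(** The reduction is 0 as soon as its [weight] is. The pole orders r [wu i] + [ws i] of the [hm i]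
    are at most [dim], so this amounts to [dim.+1] linear equations in D, fewer than the
    unknowns. *)
Lemma exists_auxiliary : exists2 D : I -> L, exists i, D i != 0 &
  reduce q b c (\sum_i (D i)%:P *: hm i) = 0.
Proof.
pose w i := weight q (reduce q b c (hm i)).
pose M := \matrix_(i < #|{: I}|, j < dim.+1) (w (enum_val i))`_j.
have : kermx M != 0.
  rewrite kermx_eq0 -row_leq_rank -ltnNge.
  exact: leq_ltn_trans (rank_leq_col M) card_I.
case/rowV0Pn => d /sub_kermxP dM d0.
exists (fun i => d 0 (enum_rank i)).
  case/matrix0Pn: d0 => i [j dj]; exists (enum_val j).
  by rewrite enum_valK -(ord1 i).
set H := \sum_i _; have wH0 : weight q (reduce q b c H) = 0.
  rewrite /H /reduce rmodp_sum ?curve_monic //.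
  rewrite (big_morph (weight q) (@weightD _ q) (weight0 _ _)).
  apply/polyP => j; rewrite coef0 coef_sum.
  under eq_bigr => i _ do
    rewrite rmodpZ ?curve_monic // weightZ comp_polyC coefCM -/(w i).
  have [ltj|leqj] := ltnP j dim.+1.
    have := congr1 (fun N : 'rV_dim.+1 => N 0 (Ordinal ltj)) dM.
    rewrite !mxE (reindex (@enum_rank I)) /=; last first.
      by exists enum_val => i _; rewrite ?enum_rankK ?enum_valK.
    by move=> s0; rewrite -[RHS]s0; apply: eq_bigr => i _; rewrite mxE enum_rankK.
  apply: big1 => i _; rewrite nth_default ?mulr0 //.
  have [_ ->] := weight_reduce_monomial b c q_gt1
     (i.1.1 * r + i.2.1) (i.1.2 * r + i.2.2).
  apply: leq_trans leqj; rewrite ltnS /dim.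
  have -> : (q * (i.1.1 * r + i.2.1) + q.+1 * (i.1.2 * r + i.2.2)
             = r * wu i + ws i)%N by rewrite /wu /ws; clear; lia.
  by rewrite leq_add ?ws_le // leq_mul2l subn1 -ltnS prednK ?wu_lt ?orbT //
    (leq_ltn_trans _ (wu_lt i)).
apply/polyP => j; apply/polyP => k; rewrite !coef0.
have [ltjq|leqj] := ltnP j q; last first.
  have -> : (reduce q b c H)`_j = 0; last by rewrite coef0.
  by apply: nth_default; apply: leq_trans (size_reduce _ _ q_gt1 _) leqj.
by rewrite -(coef_weight q_gt1 _ (size_reduce _ _ q_gt1 _)) // wH0 coef0.
Qed.

(* The fibre above a covered x consists of the q points x (y + z), z in Z, and a
   reduced polynomial has degree less than q in v; hence all its coefficients
   vanish at x. *)
Lemma card_covered : (q * #|covered| <= r ^ 2 + 2 * q ^ 2 * r)%N.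
Proof.
have [D [i0 D0] redH] := exists_auxiliary.
have r_gt0 : (0 < r)%N by apply: leq_trans ler; rewrite expn_gt0 ltnW.
pose G := \sum_i (D i ^+ r)%:P *: gm i.
have rXD (I' : finType) (F : I' -> L) :
    (\sum_i F i) ^+ r = \sum_i F i ^+ r.
  elim/big_rec2: _ => [|i x y _ <-]; last by rewrite exprDn_pchar.
  by rewrite expr0n eqn0Ngt r_gt0.
have rr (x : L) : (x ^+ r) ^+ r = x by rewrite -exprM mulnn -cardL expf_card.
have evH x v : v ^+ q = x ^+ q.-1 * v + x ^+ q.+1 + b * x ^+ q.-1 - c * x ^+ q ->
    (reduce q b c G).[v%:P].[x] = 0.
  move=> vE; rewrite reduce_eval //.
  have H0 : (\sum_i (D i)%:P *: hm i).[v%:P].[x] = 0.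
    by rewrite -(reduce_eval q_gt1 _ vE) redH !horner0.
  have evm (x' v' k : L) i j :
      (k%:P *: monomial L i j).[v'%:P].[x'] = k * (x' ^+ i * v' ^+ j).
    by rewrite !hornerZ hornerXn hornerM hornerC -rmorphXn hornerM hornerXn hornerC.
  suff : G.[v%:P].[x] ^+ r = 0.
    by move/eqP; rewrite expf_eq0 r_gt0 => /eqP.
  rewrite -[RHS]H0 /G !horner_sum rXD; apply: eq_bigr => i _; rewrite !evm !exprMn rr.
  by rewrite !(exprD, exprMn, exprM) !rr.
pose top i := (wu i + r * ws i)%N.
case: (@arg_maxnP _ i0 (fun i => D i != 0) top D0) => im Dim maxim.
have sizegm i : size (weight q (reduce q b c (gm i))) = (top i).+1.
  have [_ ->] := weight_reduce_monomial b c q_gt1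
     (i.1.1 + i.2.1 * r) (i.1.2 + i.2.2 * r).
  by rewrite /top /wu /ws; congr _.+1; clear; lia.
have wG : weight q (reduce q b c G)
    = \sum_i (D i ^+ r)%:P * weight q (reduce q b c (gm i)).
  rewrite /reduce rmodp_sum ?curve_monic //.
  rewrite (big_morph (weight q) (@weightD _ q) (weight0 _ _)).
  by apply: eq_bigr => i _; rewrite rmodpZ ?curve_monic // weightZ comp_polyC.
have wG0 : weight q (reduce q b c G) != 0.
  apply: contraNneq Dim => /(congr1 (fun f : {poly L} => f`_(top im))).
  rewrite wG coef_sum coef0 (bigD1 im) //= big1 ?addr0 => [|i neim].
    have [/monicP + _] := weight_reduce_monomial b c q_gt1
      (im.1.1 + im.2.1 * r) (im.1.2 + im.2.2 * r).
    rewrite lead_coefE sizegm coefCM /= => -> /eqP.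
    by rewrite mulr1 expf_eq0 => /andP[].
  have [->|Di] := eqVneq (D i) 0; first by rewrite expr0n eqn0Ngt r_gt0 mul0r coef0.
  have le_top : (top i <= top im)%N := maxim i Di.
  rewrite coefCM nth_default ?mulr0 // sizegm ltn_neqAle le_top andbT.
  by apply: contra neim => /eqP/w_inj->.
have size_wG : (size (weight q (reduce q b c G)) <= (r ^ 2 + 2 * q ^ 2 * r).+1)%N.
  rewrite wG; apply: leq_trans (size_sum _ _ _) _.
  apply/bigmax_leqP => i _; rewrite mul_polyC; apply: leq_trans (size_scale_leq _ _) _.
  rewrite sizegm ltnS /top.
  have : (r * ws i <= r * (r + 2 * q ^ 2 - 1))%N.
    by rewrite leq_mul2l (leq_trans (ws_le i)) ?orbT // leq_sub2r // leq_subr.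
  have := wu_lt i; rewrite mulnBr mulnDr mulnn muln1 [(r * (2 * _))%N]mulnC.
  move: (wu i) (r * ws i)%N => w s; move: r_gt0; clear.
  by case: r => [//|r' _]; rewrite -!mulnn; nia.
have szR := size_reduce b c q_gt1 G; set Rg := reduce q b c G in szR size_wG wG0 evH.
have Rg0 : Rg != 0 by apply: contraNneq wG0 => ->; rewrite weight0.
(* The term x^k v^j puts a nonzero coefficient of the weight at q k + (q + 1) j, so q k is at most
   the pole order of [Rg]. All covered x will be roots of [a], whose degree is k. *)
pose j := (size Rg).-1; pose a := Rg`_j; pose k := (size a).-1.
have ltjq : (j < q)%N by rewrite /j prednK ?size_poly_gt0.
have a0 : a != 0 by rewrite /a -[Rg`_j]/(lead_coef Rg) lead_coef_eq0.
have le_k : (q * k <= r ^ 2 + 2 * q ^ 2 * r)%N.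
  rewrite -ltnS; apply: leq_trans size_wG; apply: leq_ltn_trans (leq_addr (q.+1 * j) _) _.
  rewrite ltnNge; apply: contra a0 => /leq_sizeP/(_ _ (leqnn _)).
  by rewrite coef_weight // -[_`_k]/(lead_coef a) => /eqP; rewrite lead_coef_eq0.
apply: leq_trans le_k; rewrite leq_mul2l; apply/orP; right.
rewrite -ltnS /k prednK ?size_poly_gt0 // cardE.
apply: max_poly_roots => //; rewrite ?enum_uniq //; apply/allP => x.
rewrite mem_enum inE => /andP[x0 /existsP[y /eqP yE]]; apply/eqP.
pose hx := map_poly (horner_eval x) Rg.
suff hx0 : hx = 0 by rewrite -[a.[x]]/(horner_eval x a) -coef_map -/hx hx0 coef0.
apply: contraTeq (szR) => hx_neq0; rewrite -ltnNge.
have -> : q = size [seq x * (y + z) | z <- enum Z] by rewrite size_map -cardE.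
apply: leq_trans (_ : size hx <= _)%N; last exact: size_poly.
apply: max_poly_roots => //; last first.
  by rewrite map_inj_uniq ?enum_uniq // => z1 z2 /(mulfI x0)/addrI.
apply/allP => _ /mapP[z + ->]; rewrite mem_enum => /fixZ zq; apply/eqP.
have -> : hx.[x * (y + z)] = Rg.[(x * (y + z))%:P].[x].
  by rewrite -[RHS]/(horner_eval x _) -horner_map /= /horner_eval hornerC.
apply: evH; rewrite exprMn exprDn_pchar // zq.
have -> : y ^+ q = y + (x + b / x - c) by rewrite -yE addrC subrK.
rewrite exprS -[in LHS](prednK (ltnW q_gt1)) -[in RHS](prednK (ltnW q_gt1)).
rewrite !exprS /=; field; exact: x0.
Qed.

End Stepanov.

Lemma card_artin_schreier_fiber (L : finFieldType) q (k : L) : (1 < q)%N ->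
  (#|[set y : L | (y ^+ q - y == k)%R]| <= q)%N.
Proof.
move=> q_gt1; pose P : {poly L} := 'X^q - ('X + k%:P).
have szP : size P = q.+1.
  by rewrite size_polyDl size_polyXn // size_polyN size_XaddC.
rewrite -ltnS -szP cardE; apply: max_poly_roots; rewrite ?enum_uniq //.
  by rewrite -size_poly_gt0 szP.
apply/allP => y; rewrite mem_enum inE => /eqP yE.
by rewrite rootE !hornerE -yE; apply/eqP; ring.
Qed.

(** * From point counts to character sums *)

Section KloostermanStepanov.

Variables (C : numClosedFieldType) (L : finFieldType) (psi : L -> C).
Variables (q r : nat) (b : L) (Z : {set L}).
Hypotheses (psiP : additive_character psi) (psi_q : forall y, psi (y ^+ q) = psi y).
Hypotheses (q_gt1 : (1 < q)%N) (ler : (q ^ 3 <= r)%N) (dvdqr : (q %| r)%N).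
Hypotheses (qchar : [pchar L].-nat q) (rchar : [pchar L].-nat r).
Hypotheses (cardL : #|L| = (r ^ 2)%N).
Hypotheses (cardZ : #|Z| = q) (fixZ : forall a, a \in Z -> a ^+ q = a).

Let g (u : L * L) := u.1 + b / u.1 - (u.2 ^+ q - u.2).
Let N c := #|[set u : L * L | (u.1 != 0) && (g u == c)]|.
Let M := (r ^ 2 + 2 * q ^ 2 * r)%N.

Let N_le c : (N c <= M)%N.
Proof.
apply: leq_trans (card_covered b c q_gt1 ler dvdqr qchar rchar cardL cardZ fixZ).
pose T x := [set y : L | y ^+ q - y == x + b / x - c].
have -> : N c = (\sum_(x in covered q b c) #|T x|)%N.
  rewrite /N -sum1_card; under [RHS]eq_bigr do rewrite -sum1_card.
  rewrite pair_big_dep; apply: eq_bigl => -[x y]; rewrite !inE /g /=.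
  have [_|x0 /=] := eqVneq x 0; first by [].
  have -> : (x + b / x - (y ^+ q - y) == c) = (y ^+ q - y == x + b / x - c).
    by rewrite -subr_eq0 -[RHS]subr_eq0 -oppr_eq0; congr (_ == _); ring.
  by rewrite andb_idl // => yE; apply/existsP; exists y.
rewrite mulnC -sum_nat_const leq_sum // => x _.
exact: card_artin_schreier_fiber.
Qed.

Let sum_N : (\sum_c N c = #|L| * (#|L| - 1))%N.
Proof.
have -> : (#|L| * (#|L| - 1) = #|[set u : L * L | u.1 != 0%R]|)%N.
  rewrite mulnC subn1 -(cardsC1 (0 : L)) -[X in (_ * X)%N]cardsT -cardsX.
  by apply: eq_card => u; rewrite !inE andbT.
rewrite -[RHS]sum1_card (partition_big g xpredT) //=.
by apply: eq_bigr => c _; rewrite /N -sum1_card; apply: eq_bigl => u; rewrite !inE.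
Qed.

Lemma kloosterman_stepanov :
  `|kloosterman psi b| <= (2 * q ^ 2 * r + 1)%:R.
Proof.
have Q_gt0 : (0 < #|L|)%N by apply: ltnW (finRing_gt1 L).
(* As the values of psi sum to 0, the upper bound M may be subtracted from every
   N c; the coefficients M - N c are then nonnegative with a small sum. *)
have KE : kloosterman psi b * #|L|%:R = \sum_c psi c * ((N c)%:R - M%:R).
  under [RHS]eq_bigr do rewrite mulrBr.
  rewrite sumrB -mulr_suml (sum_character psiP) mul0r subr0.
  have -> : \sum_c psi c * (N c)%:R = \sum_(u : L * L | u.1 != 0) psi (g u).
    rewrite [RHS](partition_big g xpredT) //=; apply: eq_bigr => c _.
    rewrite mulr_natr /N -sumr_const; apply: eq_big => [u|u]; rewrite ?inE //.
    by case/andP=> _ /eqP->.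
  transitivity (\sum_(x : L | x != 0) \sum_y psi (g (x, y))); last first.
    by rewrite pair_big; apply: eq_big => -[x y]; rewrite //= andbT.
  symmetry.
  (* Invariance under the q-th power gives psi (y^q - y) = 1, so each x contributes #|L| equal
     terms. *)
  rewrite mulr_suml; apply: eq_bigr => x _.
  rewrite -sumr_const mulr_sumr; apply: eq_bigr => y _; rewrite mulr1.
  have [_ psiD _] := psiP; rewrite /g /=; set k := x + b / x.
  rewrite opprB !psiD -(conj_character psiP) psi_q.
  by rewrite -normCK (norm_character psiP) expr1n mulr1.
rewrite -(ler_pM2r (_ : 0 < #|L|%:R)) ?ltr0n // -[X in _ * X]ger0_norm ?ler0n //.
rewrite -normrM KE; apply: le_trans (ler_norm_sum _ _ _) _.
have -> : \sum_c `|psi c * ((N c)%:R - M%:R)| = (\sum_c (M - N c))%:R.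
  rewrite natr_sum; apply: eq_bigr => c _.
  by rewrite normrM (norm_character psiP) mul1r distrC -natrB ?N_le // normr_nat.
rewrite -natrM ler_nat sumnB => [|c _]; last exact: N_le.
(* The mean of M - N c over c is M - (#|L| - 1) = 2 q^2 r + 1, as #|L| = r^2. *)
rewrite sum_N sum_nat_const cardT -cardE -mulnBr mulnC leq_mul2r; apply/orP; right.
have sub_pred n m : (0 < n)%N -> (n + m - (n - 1) <= m + 1)%N by lia.
by rewrite /M -cardL; apply: sub_pred.
Qed.

End KloostermanStepanov.

(** * Quadratic extensions of finite fields *)

Lemma card_finField_pchar (F : finFieldType) p :
  p \in [pchar F] -> #|F| = (p ^ logn p #|F|)%N.
Proof. by move=> pF; apply: (card_pprimeChar pF). Qed.

Lemma odd_card_neq0 (F : finFieldType) : odd #|F| -> 2 != 0 :> F.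
Proof.
move=> oddF; apply/negP => two0.
have /card_finField_pchar cF : 2%N \in [pchar F] by rewrite inE.
move: oddF (finRing_gt1 F); rewrite cF oddX orbF => /eqP->.
by rewrite expn0.
Qed.

Lemma exists_nonsquare (F : finFieldType) : odd #|F| ->
  exists v : F, forall x, x ^+ 2 != v.
Proof.
move=> oddF; have two0 := odd_card_neq0 oddF.
case: (boolP [exists v : F, [forall x, x ^+ 2 != v]]).
  by case/existsP=> v /forallP; exists v.
move/existsPn=> nex; pose g (v : F) := odflt 0 [pick x | x ^+ 2 == v].
have gK : cancel g (fun x => x ^+ 2).
  move=> v; rewrite /g; case: pickP => [x /eqP//|x0].
  by case/negP: (nex v); apply/forallP => x; rewrite x0.
have [h hK Kh] := injF_bij (can_inj gK).
have: (1 : F) = -1.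
  by apply: (can_inj Kh); rewrite -[h 1]gK -[h (- 1)]gK !Kh sqrrN.
by move/eqP; rewrite -subr_eq0 opprK (negPf two0).
Qed.

Lemma card_FinFieldExtType (F : finFieldType) (L : fieldExtType F) :
  #|FinFieldExtType L| = (#|F| ^ \dim {:L})%N.
Proof.
pose cL := Vector.class (finvect_type L).
rewrite -(@card_vspace F (FinFieldExtType L) cL).
exact/esym/(@card_vspacef F (FinFieldExtType L) cL).
Qed.

(** Adjoin a root of X^2 - v, irreducible because it has degree 2 and no root. Later computations
    use only the coordinates in the basis 1, w, hence the bijection in the conclusion. *)
Lemma quadratic_extension (F : finFieldType) (v : F) :
    (forall x, x ^+ 2 != v) ->
  exists (L : finFieldType) (f : {rmorphism F -> L}) (w : L),
    w ^+ 2 = f v /\ bijective (fun ab : F * F => f ab.1 + f ab.2 * w).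
Proof.
move=> nsq.
have irr : irreducible_poly ('X^2 - v%:P).
  apply: cubic_irreducible; first by rewrite size_XnsubC.
  by move=> x; rewrite rootE !hornerE subr_eq0.
have [L dimL [w rw _]] := irredp_FAdjoin irr.
have [f wE] : exists f : {rmorphism F -> FinFieldExtType L},
    (w : FinFieldExtType L) ^+ 2 = f v.
  exists (GRing.in_alg L); move: rw; rewrite rootE rmorphB /= map_polyXn.
  by rewrite map_polyC !hornerE subr_eq0 => /eqP.
exists (FinFieldExtType L), f, w.
split=> //; apply: inj_card_bij; last first.
  by rewrite card_prod card_FinFieldExtType dimL size_XnsubC.
move=> [a b] [a' b'] /= E.
have E' : f (b - b') * w = f (a' - a).
  by rewrite !rmorphB /= -[f a'](addrK (f b' * w)) -E; ring.
have bb : b = b'.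
  apply/eqP; rewrite -subr_eq0; apply: contraT => nz.
  case/negP: (nsq ((a' - a) / (b - b'))); apply/eqP.
  apply: (fmorph_inj f); rewrite rmorphXn fmorph_div /= -E' mulrAC divff ?fmorph_eq0 //.
  by rewrite mul1r wE.
by move: E; rewrite bb => /addIr/fmorph_inj->.
Qed.

Section SquareRoots.

Variable F : finFieldType.
Hypothesis oddF : odd #|F|.

Definition nsqrt (D : F) : nat := #|[set y : F | y ^+ 2 == D]|.

Lemma nsqrt0 : nsqrt 0 = 1%N.
Proof.
transitivity #|[set (0 : F)]|; last exact: cards1.
apply: eq_card => y; rewrite !inE.
by rewrite expf_eq0.
Qed.

Lemma nsqrt_sqr s : s != 0 -> nsqrt (s ^+ 2) = 2.
Proof.
move=> s0; have neqs : s != - s.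
  by rewrite -subr_eq0 opprK -mulr2n -mulr_natl mulf_eq0 (negPf s0) (negPf (odd_card_neq0 oddF)).
transitivity #|[set s; - s]|; last by rewrite cards2 neqs.
by apply: eq_card => y; rewrite !inE eqf_sqr.
Qed.

Lemma nsqrt_nonsquare D : (forall x, x ^+ 2 != D) -> nsqrt D = 0%N.
Proof. by move=> nsq; apply: eq_card0 => y; rewrite inE (negPf (nsq y)). Qed.

Lemma nsqrtZ s D : s != 0 -> nsqrt (s ^+ 2 * D) = nsqrt D.
Proof.
move=> s0; rewrite /nsqrt -[RHS](card_imset _ (mulfI s0)); apply: eq_card => y.
rewrite inE; apply/eqP/imsetP => [yE|[x]].
  exists (s^-1 * y); rewrite ?mulVKf // inE exprMn yE.
  by rewrite mulrA -exprMn mulVf // expr1n mul1r.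
by rewrite inE => /eqP <- ->; rewrite exprMn.
Qed.

Lemma sum_nsqrt : (\sum_D nsqrt D = #|F|)%N.
Proof.
rewrite -[RHS]sum1_card [RHS](partition_big (fun y : F => y ^+ 2) xpredT) //=.
by apply: eq_bigr => D _; rewrite sum1dep_card.
Qed.

(** Each such sum is at most 2, since D and v D are not both nonzero squares. Summed over all D the
    total is 2 #|F|, so equality holds everywhere. *)
Lemma nsqrt_twist (v D : F) : (forall x, x ^+ 2 != v) ->
  (nsqrt D + nsqrt (v * D)%R = 2)%N.
Proof.
move=> nsq; have v0 : v != 0 by apply: contraNneq (nsq 0) => ->; rewrite expr0n.
have le2 D' : (nsqrt D' + nsqrt (v * D')%R <= 2)%N.
  have [->|D0] := eqVneq D' 0; first by rewrite mulr0 nsqrt0.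
  case: (pickP (fun s => s ^+ 2 == D')) => [s /eqP sD|nD]; last first.
    rewrite nsqrt_nonsquare ?add0n => [|x]; last by rewrite nD.
    case: (pickP (fun s => s ^+ 2 == v * D')) => [s /eqP sD|nvD].
      by rewrite -sD nsqrt_sqr // -sqrf_eq0 sD mulf_neq0.
    by rewrite nsqrt_nonsquare // => x; rewrite nvD.
  have s0 : s != 0 by rewrite -sqrf_eq0 sD.
  rewrite -sD nsqrt_sqr // mulrC nsqrtZ // nsqrt_nonsquare //.
apply/eqP; rewrite eqn_leq le2 /= leqNgt; apply/negP => lt2.
have : (\sum_D' (nsqrt D' + nsqrt (v * D')%R) < \sum_(D' : F) 2)%N.
  rewrite [X in (X < _)%N](bigD1 D) //= [X in (_ < X)%N](bigD1 D) //=.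
  by rewrite -addSn leq_add // leq_sum.
have sumv : (\sum_D' nsqrt (v * D')%R = #|F|)%N.
  by rewrite -sum_nsqrt [RHS](reindex_inj (mulfI v0)).
rewrite big_split /= sumv sum_nsqrt sum_nat_const.
by rewrite muln2 addnn ltnn.
Qed.

End SquareRoots.

Lemma sum_fibers (C : pzRingType) (F : finFieldType) (N : F -> F -> F) (G : F -> F -> C) :
  \sum_(u : F * F | N u.1 u.2 != 0) G u.1 (N u.1 u.2) =
  \sum_x \sum_(n | n != 0) G x n *+ #|[set y | N x y == n]|.
Proof.
rewrite -(pair_big_dep xpredT (fun x y => N x y != 0) (fun x y => G x (N x y))) /=.
apply: eq_bigr => x _; rewrite (partition_big (N x) (fun n => n != 0)) //=.
apply: eq_bigr => n n0; rewrite -sumr_const; apply: eq_big => [y|y /andP[_ /eqP->]//].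
by rewrite inE andb_idl // => /eqP->.
Qed.

Section QuadraticExtension.

Variables (C : numClosedFieldType) (F : finFieldType) (psi : F -> C) (b : F).
Hypotheses (oddF : odd #|F|) (psiP : additive_character psi) (b0 : b != 0).

Let G x n := psi (2 * x + 2 * b * x / n).

Let two0 : 2 != 0 :> F. Proof. exact: odd_card_neq0. Qed.

(** Write the two variables as x + y and x - y, with product n = x^2 - y^2. The summand depends on x
    and n alone; y enters only as a square root of x^2 - n. *)
Lemma kloosterman_sqr : kloosterman psi b ^+ 2 =
  \sum_x \sum_(n | n != 0) G x n *+ nsqrt (x ^+ 2 - n).
Proof.
have [_ psiD _] := psiP.
rewrite expr2 /kloosterman big_distrl /=; under eq_bigr do rewrite big_distrr /=.
rewrite pair_big /= (reindex (fun u : F * F => (u.1 + u.2, u.1 - u.2))) /=; last first.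
  exists (fun u : F * F => ((u.1 + u.2) / 2, (u.1 - u.2) / 2)) => -[x y] _ /=;
    by congr (_, _); field.
transitivity (\sum_(u : F * F | u.1 ^+ 2 - u.2 ^+ 2 != 0) G u.1 (u.1 ^+ 2 - u.2 ^+ 2)).
  apply: eq_big => -[x y] /=; first by rewrite subr_sqr mulrC mulf_eq0 negb_or.
  case/andP=> p0 m0; rewrite -psiD /G subr_sqr; congr (psi _); field.
  by rewrite p0 m0.
rewrite (sum_fibers (fun x y => x ^+ 2 - y ^+ 2) G).
apply: eq_bigr => x _; apply: eq_bigr => n _; congr (_ *+ _).
apply: eq_card => y; rewrite !inE -subr_eq0 -[RHS]subr_eq0 -oppr_eq0.
by congr (_ == _); ring.
Qed.

Variables (L : finFieldType) (f : {rmorphism F -> L}) (w : L) (v : F).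
Hypotheses (nsq : forall x, x ^+ 2 != v) (wE : w ^+ 2 = f v).

Let phi (u : F * F) := f u.1 + f u.2 * w.

Variable h : L -> F * F.
Hypotheses (hK : cancel phi h) (Kh : cancel h phi).

(** This is psi composed with the trace, which sends [f x + f y * w] to 2x. *)
Definition trace_character z := psi (2 * (h z).1).

Let v0 : v != 0. Proof. by apply: contraNneq (nsq 0) => ->; rewrite expr0n. Qed.

Let phi0 : phi (0, 0) = 0. Proof. by rewrite /phi !rmorph0 mul0r addr0. Qed.

Let phi_eq0 u : (phi u == 0) = (u == (0, 0)).
Proof. by rewrite -phi0 (can_eq hK). Qed.

Let phiD u1 u2 : phi u1 + phi u2 = phi (u1.1 + u2.1, u1.2 + u2.2).
Proof. by rewrite /phi /= !rmorphD; ring. Qed.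

Let norm_phi x y : phi (x, y) * phi (x, - y) = f (x ^+ 2 - v * y ^+ 2).
Proof.
rewrite /phi /= !(rmorphB, rmorphN, rmorphM, rmorphXn) -wE /=; ring.
Qed.

Lemma trace_character_additive : additive_character trace_character.
Proof.
have [psi0 psiD [a a1]] := psiP; split.
- by rewrite /trace_character -phi0 hK mulr0.
- move=> z1 z2; rewrite /trace_character -psiD -{1}[z1]Kh -{1}[z2]Kh phiD hK /=.
  by rewrite mulrDr.
exists (phi (a / 2, 0)); rewrite /trace_character hK /=.
by rewrite mulrCA divff // mulr1.
Qed.

(** For z with coordinates x, y and norm n = x^2 - v y^2, the traces of z and b / z are 2x and 2 b x
    / n, the same data as in [kloosterman_sqr]. After adding K^2, [nsqrt_twist] leaves twice the sum
    of psi (2 (1 + b / n) x); summing over x kills all n except -b. *)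
Lemma kloosterman_trace : kloosterman trace_character (f b) =
  2 * #|F|%:R - kloosterman psi b ^+ 2.
Proof.
have -> : kloosterman trace_character (f b) =
    \sum_x \sum_(n | n != 0) G x n *+ nsqrt (v * (x ^+ 2 - n)).
  rewrite /kloosterman (reindex phi) /=; last by exists h => u _.
  transitivity (\sum_(u : F * F | u.1 ^+ 2 - v * u.2 ^+ 2 != 0)
      G u.1 (u.1 ^+ 2 - v * u.2 ^+ 2)).
    have n0 x y : (x ^+ 2 - v * y ^+ 2 != 0) = (phi (x, y) != 0).
      rewrite -(fmorph_eq0 f) -norm_phi mulf_eq0 !phi_eq0 !xpair_eqE oppr_eq0.
      by rewrite orbb.
    apply: eq_big => -[x y] /=; first by rewrite n0.
    rewrite -n0 => n1; congr (psi _).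
    have -> : f b / phi (x, y) = phi (b * x / (x ^+ 2 - v * y ^+ 2),
                                     - (b * y / (x ^+ 2 - v * y ^+ 2))).
      have p0 : phi (x, y) != 0 by rewrite -n0.
      apply: (mulIf p0); rewrite mulfVK //.
      transitivity (f b * (phi (x, y) * phi (x, - y)) / f (x ^+ 2 - v * y ^+ 2)).
        by rewrite norm_phi mulfK // fmorph_eq0.
      by rewrite /phi /= !(rmorphN, rmorphM, fmorphV) /=; ring.
    by rewrite phiD hK /= mulrDr !mulrA.
  rewrite (sum_fibers (fun x y => x ^+ 2 - v * y ^+ 2) G).
  apply: eq_bigr => x _; apply: eq_bigr => n _; congr (_ *+ _).
  (* Multiplication by v carries the solutions y of x^2 - v y^2 = n to the square roots of v (x^2 -
     n). *)
  rewrite /nsqrt -(card_imset _ (mulfI v0)); apply: eq_card => y.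
  apply/imsetP/idP => [[y' + ->]|]; rewrite !inE.
    move=> /eqP <-; apply/eqP; ring.
  move=> /eqP yE; exists (v^-1 * y); rewrite ?mulVKf // inE.
  by rewrite exprMn yE; apply/eqP; field.
rewrite kloosterman_sqr; apply/eqP; rewrite eq_sym subr_eq; apply/eqP.
rewrite -big_split /=; under eq_bigr do rewrite -big_split /=.
have E x n : G x n *+ nsqrt (v * (x ^+ 2 - n)) + G x n *+ nsqrt (x ^+ 2 - n)
    = 2 * psi ((2 * (1 + b / n)) * x).
  rewrite -mulrnDr addnC (nsqrt_twist oddF (x ^+ 2 - n) nsq) mulr_natl.
  by rewrite /G; congr (psi _ *+ 2); ring.
under eq_bigr => x _ do under eq_bigr => n _ do rewrite E.
rewrite exchange_big /= (bigD1 (- b)) ?oppr_eq0 //= [X in _ + X]big1 ?addr0 => [|n].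
  by rewrite -mulr_sumr (sum_characterM psiP) invrN mulrN divff // subrr mulr0 eqxx.
case/andP=> n0 nb; rewrite -mulr_sumr (sum_characterM psiP) mulf_eq0 (negPf two0) /=.
have -> : 1 + b / n = (n + b) / n by field.
rewrite mulf_eq0 invr_eq0 (negPf n0) orbF addr_eq0 (negPf nb).
by rewrite mulr0.
Qed.

(** For odd q the power w^q is again a multiple of w by an element of the base field, so raising to
    the q-th power raises the first coordinate to the q-th power. *)
Lemma trace_character_frobenius q : odd q -> [pchar F].-nat q ->
    (forall y, psi (y ^+ q) = psi y) ->
  forall z, trace_character (z ^+ q) = trace_character z.
Proof.
move=> oddq qF psiq z; have qL : [pchar L].-nat q.
  by rewrite (eq_pnat _ (fmorph_pchar f)).
have wq : w ^+ q = f (v ^+ q./2) * w.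
  by rewrite -[q in LHS]odd_double_half oddq exprS -mul2n exprM wE -rmorphXn mulrC.
rewrite /trace_character -{1}[z]Kh; case: (h z) => x y /=.
have -> : phi (x, y) ^+ q = phi (x ^+ q, y ^+ q * v ^+ q./2).
  by rewrite /phi /= exprDn_pchar // exprMn wq mulrA !(rmorphM, rmorphXn).
rewrite hK /= -[in RHS]psiq exprMn.
have -> : (2 : F) ^+ q = 2 by rewrite -[2]/(1 + 1) exprDn_pchar // expr1n.
by [].
Qed.

End QuadraticExtension.

Lemma quadratic_step (C : numClosedFieldType) (F : finFieldType) (psi : F -> C) (b : F) :
    odd #|F| -> additive_character psi -> b != 0 ->
  exists (L : finFieldType) (f : {rmorphism F -> L}) (chi : L -> C),
    [/\ #|L| = (#|F| ^ 2)%N, additive_character chi,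
        kloosterman chi (f b) = 2 * #|F|%:R - kloosterman psi b ^+ 2
      & forall q, odd q -> [pchar F].-nat q -> (forall y, psi (y ^+ q) = psi y) ->
          forall z, chi (z ^+ q) = chi z].
Proof.
move=> oddF psiP b0; have [v nsq] := exists_nonsquare oddF.
have [L [f [w [wE bij]]]] := quadratic_extension nsq.
have [h hK Kh] := bij; exists L, f, (trace_character psi h); split.
- by rewrite -(bij_eq_card bij) card_prod mulnn.
- exact: (trace_character_additive oddF psiP hK Kh).
- exact: (kloosterman_trace oddF psiP b0 nsq wE hK Kh).
- exact: (trace_character_frobenius wE hK Kh).
Qed.

(** * Weil's bound for Kloosterman sums *)

Section Weil.

Variables (C : numClosedFieldType) (F : finFieldType) (psi : F -> C) (b : F).
Hypotheses (oddF : odd #|F|) (psiP : additive_character psi) (b0 : b != 0).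
Hypothesis archiC : forall x : C, 0 <= x -> exists n, x <= n%:R.

(** The expected value on floor k, defined as a mere number because the fields of the tower are only
    known to exist. *)
Fixpoint kloosterman_iter k : C :=
  if k is j.+1 then 2 * (#|F| ^ 2 ^ j)%:R - kloosterman_iter j ^+ 2
  else kloosterman psi b.

Lemma pnat_card (L : finFieldType) (f : {rmorphism F -> L}) k :
  [pchar L].-nat (#|F| ^ k)%N.
Proof.
have [p p_pr pF] := finPcharP F.
rewrite pnatX; apply/orP; left; rewrite (card_finField_pchar pF) pnatX pnatE //.
by rewrite (fmorph_pchar f) pF.
Qed.

Lemma kloosterman_tower k :
  exists (L : finFieldType) (f : {rmorphism F -> L}) (chi : L -> C) (c : L),
    [/\ #|L| = (#|F| ^ 2 ^ k)%N, additive_character chi, c != 0,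
        forall z, chi (z ^+ #|F|) = chi z
      & kloosterman chi c = kloosterman_iter k].
Proof.
elim: k => [|k [L [f [chi [c [cL chiP c0 chiF kE]]]]]].
  exists F, idfun, psi, b; split=> // z.
  by rewrite expf_card.
have oddL : odd #|L| by rewrite cL oddX oddF orbT.
have [M [g [xi [cM xiP xiE xiF]]]] := quadratic_step oddL chiP c0.
exists M, (g \o f), xi, (g c); split=> //.
- by rewrite cM cL -expnM -expnSr.
- by rewrite fmorph_eq0.
- by apply: xiF => //; rewrite -[#|F|]expn1 pnat_card.
- by rewrite xiE kE cL.
Qed.

Lemma kloosterman_iter_real k : kloosterman_iter k \is Num.real.
Proof.
elim: k => [|k IHk] /=.
  by rewrite CrealE kloosterman_real.
by rewrite rpredB ?rpredM ?rpredX ?realn.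
Qed.

(** Floor k.+1 has order r^2 with r = #|F|^(2^k), so the assumption on k says r >= #|F|^3. The set Z
    is the image of F, and the factor 3 absorbs the summand 1 of [kloosterman_stepanov]. *)
Lemma kloosterman_iter_bound k : (3 <= 2 ^ k)%N ->
  `|kloosterman_iter k.+1| <= (3 * #|F| ^ 2 * #|F| ^ 2 ^ k)%:R.
Proof.
move=> le3k; have [L [f [chi [c [cL chiP c0 chiF <-]]]]] := kloosterman_tower k.+1.
have F_gt1 : (1 < #|F|)%N := finRing_gt1 F.
apply: le_trans (_ : (2 * #|F| ^ 2 * #|F| ^ 2 ^ k + 1)%:R <= _).
  apply: (@kloosterman_stepanov _ _ _ #|F| _ _ [set f a | a in F]) => //.
  - by rewrite leq_pexp2l // ltnW.
  - by rewrite dvdn_exp // expn_gt0.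
  - by rewrite -[#|F|]expn1 pnat_card.
  - exact: pnat_card.
  - by rewrite cL -expnM -expnSr.
  - by rewrite card_imset //; apply: fmorph_inj.
  - by move=> _ /imsetP[a _ ->]; rewrite -rmorphXn expf_card.
rewrite ler_nat.
have : (0 < #|F| ^ 2 * #|F| ^ 2 ^ k)%N by rewrite muln_gt0 !expn_gt0 ltnW.
by rewrite -!mulnA; lia.
Qed.

(* If K^2 > 4q the recursion K -> 2q - K^2, q -> q^2 makes K^2 / q grow
   without bound along the tower, which contradicts the Stepanov bound. *)
Theorem weil_kloosterman : kloosterman psi b ^+ 2 <= (4 * #|F|)%:R.
Proof.
have Kreal := kloosterman_iter_real.
rewrite real_leNgt ?rpredX ?realn ?(Kreal 0%N) //; apply/negP => gt4.
have F_gt0 : (0 < #|F|)%N by apply: ltnW (finRing_gt1 F).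
pose q k : C := (#|F| ^ 2 ^ k)%:R.
have q_gt0 k : 0 < q k by rewrite ltr0n expn_gt0 F_gt0.
have qS k : q k.+1 = q k ^+ 2 by rewrite /q -natrX -expnM expnSr.
pose x k := kloosterman_iter k ^+ 2 / q k.
have xreal k : x k \is Num.real by rewrite rpred_div ?rpredX ?realn.
have xS k : x k.+1 = (x k - 2) ^+ 2.
  have := lt0r_neq0 (q_gt0 k); rewrite /x /= -/(q k) qS => qk; field.
  exact: qk.
pose e := x 0%N - 4.
have e_gt0 : 0 < e.
  rewrite subr_gt0 /x ltr_pdivlMr // /q expn0 expn1.
  by move: gt4; rewrite natrM.
(* An excess s over 4 becomes 4 s + s^2 at the next floor; linear growth already suffices. *)
have grow k : 4 + k.+1%:R * e <= x k.
  elim: k => [|k IHk]; first by rewrite mul1r /e addrC subrK.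
  rewrite xS; set s := k.+1%:R * e in IHk.
  have le_es : e <= s by rewrite ler_peMl ?(ltW e_gt0) // ler1n.
  have s_ge0 : 0 <= s := le_trans (ltW e_gt0) le_es.
  have le2 : 2 + s <= x k - 2 by rewrite lerBrDr; apply: le_trans IHk; rewrite addrAC -natrD.
  have s2_ge0 : 0 <= 2 + s by rewrite addr_ge0 ?ler0n.
  apply: le_trans (_ : (2 + s) ^+ 2 <= _); last first.
    by apply: lerXn2r => //; rewrite nnegrE // (le_trans s2_ge0).
  rewrite -subr_ge0.
  have -> : (2 + s) ^+ 2 - (4 + k.+2%:R * e) = (s - e) + 2 * s + s ^+ 2.
    by rewrite /s -[k.+2]addn1 natrD; ring.
  apply: addr_ge0; last exact: exprn_ge0.
  by apply: addr_ge0; [rewrite subr_ge0 | apply: mulr_ge0; rewrite ?ler0n].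
(* The number 9 #|F|^4 is the square of the factor 3 #|F|^2 in [kloosterman_iter_bound], hence a
   bound for x on all high floors. *)
have [n len] : exists n, 9 * (#|F| ^ 4)%:R / e <= n%:R :> C.
  by apply: archiC; rewrite !mulr_ge0 ?invr_ge0 ?ler0n // ltW.
have le3 : (3 <= 2 ^ n.+2)%N.
  by rewrite !expnS mulnA (leq_trans (_ : 3 <= 4 * 1)%N) // leq_mul2l expn_gt0.
have xle : x n.+3 <= 9 * (#|F| ^ 4)%:R.
  rewrite /x ler_pdivrMr // -real_normK ?Kreal // qS.
  have := kloosterman_iter_bound le3 => le_b.
  apply: le_trans (_ : (3 * #|F| ^ 2 * #|F| ^ 2 ^ n.+2)%:R ^+ 2 <= _).
    by apply: lerXn2r => //; rewrite nnegrE ?normr_ge0 ?ler0n.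
  by rewrite /q -!natrX -!natrM ler_nat !expnMn -expnM -(expnD _ 2 2).
have : 4 + n.+4%:R * e <= n%:R * e.
  apply: le_trans (grow n.+3) _; apply: le_trans xle _.
  by rewrite -ler_pdivrMr.
apply/negP; rewrite real_leNgt ?realE; last 2 first.
- by rewrite addr_ge0 ?mulr_ge0 ?ler0n ?(ltW e_gt0).
- by rewrite mulr_ge0 ?ler0n ?(ltW e_gt0).
rewrite negbK; apply: (@le_lt_trans _ _ (n.+4%:R * e)).
  by rewrite ler_pM2r // ler_nat -addn4 leq_addr.
by rewrite ltrDr ltr0n.
Qed.

End Weil.

(** * Gauss and Salie sums *)

Section GaussSalie.

Variables (C : numClosedFieldType) (F : finFieldType) (psi : F -> C).
Hypotheses (oddF : odd #|F|) (psiP : additive_character psi).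

Let two0 : 2 != 0 :> F. Proof. exact: odd_card_neq0. Qed.
Let four0 : 4 != 0 :> F.
Proof. by rewrite -[4]/((2 * 2)%:R) natrM mulf_neq0. Qed.

Definition quadratic_character (x : F) : C := (nsqrt x)%:R - 1.
Local Notation eta := quadratic_character.

Lemma eta0 : eta 0 = 0. Proof. by rewrite /eta nsqrt0 subrr. Qed.

Lemma eta_sqr s : s != 0 -> eta (s ^+ 2) = 1.
Proof. by move=> s0; rewrite /eta nsqrt_sqr // -addrA subrr addr0. Qed.

Lemma eta_nonsquare v : (forall x, x ^+ 2 != v) -> eta v = -1.
Proof. by move=> nsq; rewrite /eta nsqrt_nonsquare // sub0r. Qed.

Lemma square_or_nonsquare (v : F) : {s | v = s ^+ 2} + {forall x, x ^+ 2 != v}.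
Proof.
case: (pickP (fun s => s ^+ 2 == v)) => [s /eqP sv|nv]; first by left; exists s.
by right=> x; rewrite nv.
Qed.

Lemma etaM x y : eta (x * y) = eta x * eta y.
Proof.
have [->|x0] := eqVneq x 0; first by rewrite mul0r eta0 mul0r.
case: (square_or_nonsquare x) => [[s xs]|nsq].
  have s0 : s != 0 by rewrite -sqrf_eq0 -xs.
  by rewrite xs eta_sqr // mul1r /eta nsqrtZ.
rewrite (eta_nonsquare nsq) mulN1r /eta.
have := congr1 (GRing.natmul (1 : C)) (nsqrt_twist oddF y nsq).
by rewrite natrD => E; rewrite opprB -[in RHS](addrK (nsqrt (x * y))%:R (nsqrt y)%:R) E; ring.
Qed.

Lemma eta_sq x : x != 0 -> eta x ^+ 2 = 1.
Proof. by move=> x0; rewrite expr2 -etaM -expr2 eta_sqr. Qed.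

Lemma etaV x : x != 0 -> eta x^-1 = eta x.
Proof.
move=> x0; have : eta x * eta x^-1 = 1 by rewrite -etaM divff // -(expr1n F 2) eta_sqr ?oner_eq0.
by move/(congr1 ( *%R (eta x))); rewrite mulrA -expr2 eta_sq // mul1r mulr1.
Qed.

Lemma norm_eta x : x != 0 -> `|eta x| = 1.
Proof.
move=> x0; apply/eqP; rewrite -(@pexpr_eq1 _ _ 2) ?normr_ge0 //.
by rewrite -normrX eta_sq // normr1.
Qed.

Definition gauss_sum s := \sum_z psi (s * z ^+ 2).

Lemma gauss_sum_eta s : s != 0 -> gauss_sum s = \sum_x eta x * psi (s * x).
Proof.
move=> s0; under [RHS]eq_bigr do rewrite mulrBl mul1r.
rewrite sumrB (sum_characterM psiP) (negPf s0) subr0 /gauss_sum.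
rewrite (partition_big (fun z => z ^+ 2) xpredT) //=; apply: eq_bigr => x _.
rewrite mulr_natl -sumr_const; apply: eq_big => [z|z /eqP->]; by rewrite ?inE.
Qed.

Lemma gauss_sumE s : s != 0 -> gauss_sum s = eta s * gauss_sum 1.
Proof.
move=> s0; rewrite !gauss_sum_eta ?oner_eq0 // mulr_sumr.
rewrite [RHS](reindex_inj (mulfI s0)) /=; apply: eq_bigr => x _.
by rewrite mul1r etaM !mulrA -expr2 eta_sq // mul1r.
Qed.

(** Factoring z1^2 - z2^2 turns the square into the double sum of psi (s x y). *)
Lemma normsq_gauss_sum s : s != 0 -> `|gauss_sum s| ^+ 2 = #|F|%:R.
Proof.
move=> s0; rewrite normCK /gauss_sum rmorph_sum big_distrl /=.
under eq_bigr do rewrite big_distrr /=.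
have [psi0 psiD _] := psiP.
rewrite pair_big /= (reindex (fun u : F * F => ((u.1 + u.2) / 2, (u.2 - u.1) / 2))) /=; last first.
  exists (fun u : F * F => (u.1 - u.2, u.1 + u.2)) => -[x y] _ /=;
    by congr (_, _); field.
transitivity (\sum_(x : F) \sum_(y : F) psi ((s * x) * y)).
  rewrite pair_big /=; apply: eq_bigr => -[x y] _ /=.
  by rewrite (conj_character psiP) -psiD; congr (psi _); field.
rewrite (bigD1 0) //= (sum_characterM psiP) mulr0 eqxx big1 ?addr0 // => x x0.
by rewrite (sum_characterM psiP) mulf_eq0 (negPf s0) (negPf x0).
Qed.

Definition salie a c := \sum_(x | x != 0) eta x * psi (a * x + c / x).

(** Replacing x by c / (a x) exchanges the two terms in the argument of psi and multiplies eta by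
    eta (a c) = -1. *)
Lemma salie_nonsquare a c : a != 0 -> c != 0 -> (forall x, x ^+ 2 != a * c) ->
  salie a c = 0.
Proof.
move=> a0 c0 nsq; have k0 : c / a != 0 by rewrite mulf_neq0 ?invr_eq0.
have inj : injective (fun x => (c / a) / x) by move=> x y /(mulfI k0)/invr_inj.
have SN : salie a c = - salie a c.
  rewrite {1}/salie (reindex_inj inj) -sumrN /=.
  apply: eq_big => [x|x]; rewrite mulf_eq0 (negPf k0) /= invr_eq0 // => x0.
  have -> : a * (c / a / x) + c / (c / a / x) = a * x + c / x.
    by field; rewrite x0 a0 c0.
  have -> : c / a / x = (a * c) * (a^-1 ^+ 2 * x^-1) by field; rewrite x0 a0.
  rewrite etaM (eta_nonsquare nsq) etaM eta_sqr ?invr_eq0 // etaV //.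
  by rewrite mul1r !mulN1r mulNr.
apply/eqP; have /eqP := SN; rewrite -subr_eq0 opprK -mulr2n -mulr_natl.
by rewrite mulf_eq0 pnatr_eq0.
Qed.

(* Substituting u = (x - 1)^2 / x, for which eta u = eta x, turns the sum over
   x != 1 into one over u weighted by the number 1 + eta (u (u + 4)) of
   solutions x. *)
Lemma sum_eta_shift k : k != 0 ->
  \sum_(x | x != 0) eta x * psi (k * ((x - 1) ^+ 2 / x)) =
  gauss_sum k * (1 + psi (- (4 * k))).
Proof.
move=> k0; have [psi0 psiD _] := psiP; pose h x : F := (x - 1) ^+ 2 / x.
(* The equation (x - 1)^2 = u x is quadratic in x, of discriminant u (u + 4). *)
have cardh u : u != 0 -> #|[set x | (x != 0) && (h x == u)]| = nsqrt (u * (u + 4)).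
  move=> u0; rewrite /nsqrt.
  rewrite -(card_imset _ (can_inj (fun x => mulKf two0 x : 2^-1 * (2 * x) = x))).
  rewrite -[RHS](card_imset _ (addrI (2 + u))); apply: eq_card => y.
  have hE x : (x != 0) && (h x == u) = ((2 * x - (2 + u)) ^+ 2 == u * (u + 4)).
    have -> : ((2 * x - (2 + u)) ^+ 2 == u * (u + 4)) = (4 * ((x - 1) ^+ 2 - u * x) == 0).
      by rewrite -[LHS]subr_eq0; congr (_ == _); ring.
    rewrite mulf_eq0 (negPf four0) /= subr_eq0.
    have [->|x0] := eqVneq x 0.
      by rewrite mulr0 sub0r sqrrN expr1n oner_eq0.
    by rewrite /h -(inj_eq (mulIf x0)) divfK.
  apply/imsetP/imsetP => -[x xin ->]; move: xin; rewrite inE.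
    rewrite hE => /eqP xE; exists (2 * x - (2 + u)); last by rewrite addrC subrK.
    by rewrite inE xE.
  move=> /eqP xE; exists ((2 + u + x) / 2); last by rewrite mulrC divfK.
  by rewrite inE hE mulrC divfK // [2 + u + x]addrC addrK xE.
rewrite (bigD1 1) ?oner_eq0 //= subrr expr0n mul0r mulr0 psi0 mulr1.
have -> : eta 1 = 1 by rewrite -(expr1n F 2) eta_sqr ?oner_eq0.
have -> : \sum_(x | (x != 0) && (x != 1)) eta x * psi (k * ((x - 1) ^+ 2 / x)) =
    \sum_(u | u != 0) (eta u + eta (u + 4)) * psi (k * u).
  rewrite (partition_big h (fun u => u != 0)) /=; last first.
    by move=> x /andP[x0 x1]; rewrite /h mulf_eq0 sqrf_eq0 invr_eq0 subr_eq0 negb_or x0 x1.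
  apply: eq_bigr => u u0.
  transitivity (\sum_(x in [set x | (x != 0) && (h x == u)]) eta u * psi (k * u)).
    apply: eq_big => x; rewrite ?inE.
      rewrite -andbA; congr (_ && _); rewrite andb_idl // => /eqP hx.
      by apply: contraNneq u0 => x1; rewrite -hx /h x1 subrr expr0n mul0r.
    case/andP=> /andP[x0 x1] /eqP <-; rewrite /h etaM eta_sqr ?subr_eq0 // etaV //.
    by rewrite mul1r.
  rewrite sumr_const cardh // -[LHS]mulr_natr.
  have -> : (nsqrt (u * (u + 4)))%:R = 1 + eta u * eta (u + 4).
    by rewrite -etaM /quadratic_character [RHS]addrC subrK.
  have := eta_sq u0; move: (eta u) (eta (u + 4)) => e1 e2 e12.
  have -> : e1 * psi (k * u) * (1 + e1 * e2) = (e1 + e1 ^+ 2 * e2) * psi (k * u) by ring.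
  by rewrite e12 mul1r.
(* The term at u = 0 is eta 0 + eta 4 = 1; it cancels the term x = 1 split off above. *)
have sum0 (G : F -> C) : \sum_(u | u != 0) G u = \sum_u G u - G 0.
  by rewrite [X in _ = X - _](bigD1 0) //= addrC addrK.
rewrite sum0; under eq_bigr do rewrite mulrDl.
rewrite big_split /= -gauss_sum_eta // eta0 add0r mulr0 psi0 mulr1 add0r.
have -> : eta 4 = 1.
  have -> : 4 = 2 ^+ 2 :> F by ring.
  exact: eta_sqr.
rewrite (reindex_inj (addIr (- 4))) /=.
under eq_bigr => u _ do rewrite subrK mulrBr psiD mulrA.
rewrite -mulr_suml -gauss_sum_eta // (mulrC k 4); ring.
Qed.

(** If a c = k^2, scaling x by k / a turns a x + c / x into k (x + 1 / x) = 2 k + k (x - 1)^2 / x,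
    and [sum_eta_shift] evaluates the sum. *)
Lemma normsq_salie_le a c : a != 0 -> c != 0 -> `|salie a c| ^+ 2 <= (4 * #|F|)%:R.
Proof.
move=> a0 c0; case: (square_or_nonsquare (a * c)) => [[k acE]|nsq]; last first.
  by rewrite salie_nonsquare // normr0 expr0n ler0n.
have k0 : k != 0 by rewrite -sqrf_eq0 -acE mulf_neq0.
have ka0 : k / a != 0 by rewrite mulf_neq0 ?invr_eq0.
have [psi0 psiD _] := psiP.
have -> : salie a c = eta (k / a) * psi (2 * k) * (gauss_sum k * (1 + psi (- (4 * k)))).
  rewrite -sum_eta_shift // mulr_sumr /salie (reindex_inj (mulfI ka0)) /=.
  apply: eq_big => [x|x]; rewrite mulf_eq0 (negPf ka0) //= => x0.
  rewrite (etaM (k / a) x).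
  have -> : psi (a * (k / a * x) + c / (k / a * x))
      = psi (2 * k) * psi (k * ((x - 1) ^+ 2 / x)).
    rewrite -psiD; congr (psi _).
    have -> : c = k ^+ 2 / a by rewrite -acE mulrC mulKf.
    by field; rewrite a0 x0 k0.
  by ring.
rewrite !normrM norm_eta // (norm_character psiP) !mul1r exprMn normsq_gauss_sum //.
rewrite mulrC natrM ler_pM2r ?ltr0n; last exact: ltnW (finRing_gt1 F).
apply: le_trans (_ : (2 : C) ^+ 2 <= _); last by rewrite -natrX.
apply: lerXn2r; rewrite ?nnegrE ?normr_ge0 ?ler0n //.
apply: le_trans (ler_normD _ _) _.
by rewrite normr1 (norm_character psiP).
Qed.

End GaussSalie.

(** * Operator norms of the two graphs *)

Lemma sum_rV_prod (C : comPzRingType) (F : finType) d (g : 'I_d -> F -> C) :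
  \sum_(z : 'rV[F]_d) \prod_i g i (z 0 i) = \prod_i \sum_a g i a.
Proof.
rewrite bigA_distr_bigA (reindex (fun h : {ffun 'I_d -> F} => \row_i h i)) /=.
  by apply: eq_bigr => h _; apply: eq_bigr => i _; rewrite mxE.
exists (fun z : 'rV_d => [ffun i => z 0 i]) => z _.
  by apply/ffunP => i; rewrite ffunE mxE.
by apply/rowP => i; rewrite mxE ffunE.
Qed.

Section Fourier.

Variables (C : numClosedFieldType) (F : finFieldType) (d : nat) (psi : F -> C).
Hypothesis psiP : additive_character psi.
Local Notation V := 'rV[F]_d.
Local Notation q := (#|F|).

Let psi0 : psi 0 = 1. Proof. by case: psiP. Qed.
Let psiD x y : psi (x + y) = psi x * psi y. Proof. by case: psiP. Qed.
Let q_gt0 : (0 < q)%N. Proof. exact: ltnW (finRing_gt1 F). Qed.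
Let qC : 0 < q%:R :> C. Proof. by rewrite ltr0n. Qed.

Lemma character_sum I (r : seq I) (a : I -> F) :
  psi (\sum_(i <- r) a i) = \prod_(i <- r) psi (a i).
Proof. exact: (big_morph psi psiD psi0). Qed.

Lemma dotprodDr (x y z : V) : dotprod x (y + z) = dotprod x y + dotprod x z.
Proof. by rewrite -big_split; apply: eq_bigr => i _; rewrite mxE mulrDr. Qed.

Lemma dotprodNr (x y : V) : dotprod x (- y) = - dotprod x y.
Proof. by rewrite -sumrN; apply: eq_bigr => i _; rewrite mxE mulrN. Qed.

Lemma sum_character_dotprod (w : V) :
  \sum_m psi (dotprod m w) = if w == 0 then (q ^ d)%:R else 0.
Proof.
under eq_bigr do rewrite character_sum.
rewrite (sum_rV_prod (fun i a => psi (a * w 0 i))).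
under eq_bigr => i _ do
  (under eq_bigr do rewrite mulrC; rewrite (sum_characterM psiP)).
have [->|w0] := eqVneq w 0.
  under eq_bigr do rewrite mxE eqxx.
  by rewrite prodr_const card_ord natrX.
have /rV0Pn[i wi] := w0; by rewrite (bigD1 i) //= (negPf wi) mul0r.
Qed.

Lemma sum_character_ne0 c :
  \sum_(s | s != 0) psi (s * c) = (if c == 0 then q%:R else 0) - 1.
Proof.
have := sum_characterM psiP c; rewrite (bigD1 0) //= mulr0 psi0 => <-.
by rewrite addrC addrK; apply: eq_bigr => s _; rewrite mulrC.
Qed.

(** Subtracting the density 1 / q removes exactly the trivial frequency s = 0. *)
Lemma indicator_sub_mean c :
  (c == 0)%:R - q%:R^-1 = q%:R^-1 * \sum_(s | s != 0) psi (s * c).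
Proof.
rewrite sum_character_ne0 mulrBr mulr1; congr (_ - _).
by case: (c == 0); rewrite ?mulVf ?mulr0 // lt0r_neq0.
Qed.

Definition fourier (f : V -> C) (m : V) := \sum_x f x * psi (dotprod m x).

Lemma plancherel (f : V -> C) :
  \sum_m `|fourier f m| ^+ 2 = (q ^ d)%:R * \sum_x `|f x| ^+ 2.
Proof.
transitivity (\sum_m \sum_(x : V) \sum_(y : V)
    f x * (f y)^* * psi (dotprod m (x - y))).
  apply: eq_bigr => m _; rewrite normCK /fourier rmorph_sum big_distrl /=.
  apply: eq_bigr => x _; rewrite big_distrr /=; apply: eq_bigr => y _.
  rewrite rmorphM /= (conj_character psiP) dotprodDr dotprodNr psiD; ring.
rewrite exchange_big mulr_sumr /=; apply: eq_bigr => x _.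
rewrite exchange_big (bigD1 x) //= -mulr_sumr sum_character_dotprod subrr eqxx.
rewrite big1 ?addr0 => [|y neyx]; first by rewrite -normCK mulrC.
by rewrite -mulr_sumr sum_character_dotprod subr_eq0 eq_sym (negPf neyx) mulr0.
Qed.

Lemma fourier_convolution (b f : V -> C) m :
  fourier (fun x => \sum_y b (x - y) * f y) m = fourier b m * fourier f m.
Proof.
rewrite /fourier; under eq_bigr do rewrite mulr_suml.
rewrite exchange_big /= mulr_sumr; apply: eq_bigr => y _.
rewrite (reindex_inj (addIr y)) mulr_suml /=; apply: eq_bigr => x _.
by rewrite addrK dotprodDr psiD; ring.
Qed.

Section Distance.

Hypotheses (oddF : odd q) (d_gt0 : (0 < d)%N).
Hypothesis archiC : forall x : C, 0 <= x -> exists n, x <= n%:R.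
Variable t : F.
Hypothesis t0 : t != 0.

Let two0 : 2 != 0 :> F. Proof. exact: odd_card_neq0. Qed.
Let four0 : 4 != 0 :> F.
Proof. by rewrite -[4]/((2 * 2)%:R) natrM mulf_neq0. Qed.

Let K (z : V) : C := (sqnorm z == t)%:R - q%:R^-1.

(** Completing the square in each coordinate, with shift m_i / (2 s), leaves d one-variable Gauss
    sums. *)
Lemma sum_character_quadratic s (m : V) : s != 0 ->
  \sum_(z : V) psi (s * sqnorm z + dotprod m z) =
  psi (- (sqnorm m / (4 * s))) * (quadratic_character C s * gauss_sum psi 1) ^+ d.
Proof.
move=> s0.
transitivity (\sum_(z : V) \prod_i psi (s * z 0 i ^+ 2 + m 0 i * z 0 i)).
  by apply: eq_bigr => z _; rewrite -character_sum big_split /= mulr_sumr.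
rewrite (sum_rV_prod (fun i a => psi (s * a ^+ 2 + m 0 i * a))).
have -> : - (sqnorm m / (4 * s)) = \sum_i - (m 0 i ^+ 2 / (4 * s)).
  by rewrite sumrN mulr_suml.
rewrite character_sum -[in X in _ * X](card_ord d) -prodr_const -big_split /=.
apply: eq_bigr => i _; rewrite -gauss_sumE // /gauss_sum mulr_sumr.
rewrite (reindex_inj (addIr (- (m 0 i / (2 * s))))) /=; apply: eq_bigr => a _.
rewrite -psiD; congr (psi _); field; by rewrite ?s0 ?two0 ?four0.
Qed.

Lemma normsq_twisted_sum (n : F) :
  `|\sum_(s | s != 0) quadratic_character C s ^+ d * psi (- (s * t) - n / (4 * s))| ^+ 2
    <= (4 * q)%:R.
Proof.
have one_le : (1 : C) <= (4 * q)%:R by rewrite ler1n muln_gt0.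
have [oddd|evend] := boolP (odd d).
  have etaX (s : F) : s != 0 -> quadratic_character C s ^+ d = quadratic_character C s.
    move=> s0; rewrite -[d]odd_double_half oddd exprS -mul2n exprM eta_sq //.
    by rewrite expr1n mulr1.
  have [->|n0] := eqVneq n 0.
    suff -> : \sum_(s | s != 0) quadratic_character C s ^+ d
        * psi (- (s * t) - 0 / (4 * s)) = gauss_sum psi (- t).
      by rewrite (normsq_gauss_sum oddF psiP) ?oppr_eq0 // ler_nat leq_pmull.
    rewrite (gauss_sum_eta psiP) ?oppr_eq0 // [RHS](bigD1 0) //= eta0 mul0r add0r.
    apply: eq_bigr => s s0; rewrite etaX // mul0r subr0; congr (_ * psi _); ring.
  have -> : \sum_(s | s != 0) quadratic_character C s ^+ d
        * psi (- (s * t) - n / (4 * s)) = salie psi (- t) (- n / 4).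
    apply: eq_bigr => s s0; rewrite etaX //; congr (_ * psi _); field.
    by rewrite s0 four0.
  by apply: normsq_salie_le; rewrite ?mulf_neq0 ?oppr_eq0 ?invr_eq0.
have etaX (s : F) : s != 0 -> quadratic_character C s ^+ d = 1.
  move=> s0; rewrite -[d]odd_double_half (negPf evend) -mul2n exprM eta_sq //.
  by rewrite expr1n.
have [->|n0] := eqVneq n 0.
  suff -> : \sum_(s | s != 0) quadratic_character C s ^+ d
        * psi (- (s * t) - 0 / (4 * s)) = -1.
    by rewrite normrN1 expr1n.
  rewrite -[RHS]add0r -[X in X - 1](_ : (if - t == 0 then q%:R else 0) = 0 :> C).
    rewrite -sum_character_ne0; apply: eq_bigr => s s0.
    by rewrite etaX // mul1r mul0r subr0 mulrN.
  by rewrite oppr_eq0 (negPf t0).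
have -> : \sum_(s | s != 0) quadratic_character C s ^+ d
        * psi (- (s * t) - n / (4 * s)) = kloosterman psi (t * n / 4).
  (* With s = - x / t, the argument - s t - n / (4 s) becomes x + (t n / 4) / x. *)
  have nt0 : - t^-1 != 0 by rewrite oppr_eq0 invr_eq0.
  rewrite /kloosterman (reindex_inj (mulfI nt0)) /=.
  apply: eq_big => [s|s]; rewrite mulf_eq0 (negPf nt0) //= => s0.
  rewrite etaX ?mulf_neq0 // mul1r; congr (psi _); field.
  by rewrite s0 t0 four0 oppr_eq0 oner_eq0.
rewrite real_normK; last by rewrite CrealE (kloosterman_real psiP).
by apply: weil_kloosterman; rewrite // !mulf_neq0 ?invr_eq0.
Qed.

(** The three factors contribute q^-2, q^d and at most 4 q. The frequency m = 0 obeys the same bound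
    because the mean has been subtracted. *)
Lemma normsq_fourier_sphere m : `|fourier K m| ^+ 2 <= (4 * q ^ d.-1)%:R.
Proof.
pose T := \sum_(s | s != 0) quadratic_character C s ^+ d
  * psi (- (s * t) - sqnorm m / (4 * s)).
have KE : fourier K m = q%:R^-1 * (gauss_sum psi 1 ^+ d * T).
  rewrite /fourier /K; under eq_bigr do
    rewrite -subr_eq0 indicator_sub_mean -mulrA mulr_suml.
  rewrite -mulr_sumr exchange_big /=; congr (_ * _); rewrite /T mulr_sumr.
  apply: eq_bigr => s s0.
  transitivity (psi (- (s * t)) * \sum_(z : V) psi (s * sqnorm z + dotprod m z)).
    rewrite mulr_sumr; apply: eq_bigr => z _; rewrite -!psiD; congr (psi _); ring.
  rewrite sum_character_quadratic // psiD exprMn; ring.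
rewrite KE !normrM !exprMn normrV ?unitfE ?(lt0r_neq0 qC) // normr_nat.
rewrite normrX exprAC (normsq_gauss_sum oddF psiP) ?oner_eq0 //.
rewrite exprVn mulrA mulrC.
have qd : q%:R ^- 2 * q%:R ^+ d * (4 * q)%:R = (4 * q ^ d.-1)%:R :> C.
  rewrite -{1}(prednK d_gt0) (exprS _ d.-1) !natrM natrX.
  by field; exact: lt0r_neq0.
rewrite -qd mulrC ler_pM2l ?normsq_twisted_sum //.
by rewrite mulr_gt0 ?invr_gt0 ?exprn_gt0.
Qed.

Lemma distance_operator_bound (f : V -> C) :
  \sum_x `|\sum_y ((dist_adj t x y)%:R - q%:R^-1) * f y| ^+ 2 <=
    (4 * q ^ d.-1)%:R * \sum_x `|f x| ^+ 2.
Proof.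
have qd0 : 0 < (q ^ d)%:R :> C by rewrite ltr0n expn_gt0 q_gt0.
rewrite -(ler_pM2l qd0) mulrCA -!plancherel mulr_sumr.
apply: ler_sum => m _.
rewrite (fourier_convolution K) normrM exprMn ler_wpM2r ?exprn_ge0 ?normr_ge0 //.
exact: normsq_fourier_sphere.
Qed.

End Distance.

Lemma plancherel1 (g : F -> C) :
  \sum_c `|\sum_u g u * psi (u * c)| ^+ 2 = q%:R * \sum_u `|g u| ^+ 2.
Proof.
transitivity (\sum_c \sum_u \sum_v g u * (g v)^* * psi ((u - v) * c)).
  apply: eq_bigr => c _; rewrite normCK rmorph_sum big_distrl /=.
  apply: eq_bigr => u _; rewrite big_distrr /=; apply: eq_bigr => v _.
  rewrite rmorphM /= (conj_character psiP) mulrBl psiD; ring.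
rewrite exchange_big mulr_sumr /=; apply: eq_bigr => u _.
rewrite exchange_big (bigD1 u) //= -mulr_sumr (sum_characterM psiP) subrr eqxx.
rewrite big1 ?addr0 => [|v nevu]; first by rewrite -normCK mulrC.
by rewrite -mulr_sumr (sum_characterM psiP) subr_eq0 eq_sym (negPf nevu) mulr0.
Qed.

(* Replacing x by a x changes t into t / a. Averaging over all a != 0 makes
   Plancherel in the variable t / a applicable, whereas the trivial bound for
   fixed t loses a factor q. *)
Lemma product_operator_bound (t : F) (f : V -> C) : t != 0 -> (0 < d)%N ->
  \sum_x `|\sum_y ((prod_adj t x y)%:R - q%:R^-1) * f y| ^+ 2 <=
    (q ^ d.-1)%:R * \sum_x `|f x| ^+ 2.
Proof.
move=> t0 d_gt0; pose H := fourier f.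
pose S c x := \sum_(u | u != 0) H (u *: x) * psi (u * c).
have BE x : \sum_y ((prod_adj t x y)%:R - q%:R^-1) * f y = q%:R^-1 * S (- t) x.
  rewrite /prod_adj; under eq_bigr do
    rewrite -subr_eq0 indicator_sub_mean -mulrA mulr_suml.
  rewrite -mulr_sumr exchange_big /=; congr (_ * _); apply: eq_bigr => s _.
  rewrite /H /fourier mulr_suml; apply: eq_bigr => y _.
  have -> : dotprod (s *: x) y = s * dotprod x y.
    by rewrite mulr_sumr; apply: eq_bigr => i _; rewrite mxE mulrA.
  by rewrite mulrBr psiD mulrN mulrC mulrA.
have scale_inj (a : F) : a != 0 -> injective (fun x : V => a *: x).
  by move=> a0 x y E; rewrite -[x](scalerK a0) E scalerK.
(* By the convention 0^-1 = 0, [h] fixes 0 and is a bijection of F. Its value at 0 accounts for the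
   nonnegative term that is dropped at the end. *)
pose h a : F := - t / a.
have h_inj : injective h.
  by move=> a b /(mulfI _)-/(_ _)/invr_inj ->; rewrite // oppr_eq0.
have Sscale a x : a != 0 -> S (- t) (a *: x) = S (h a) x.
  move=> a0; rewrite /S [RHS](reindex_inj (mulIf a0)) /=.
  apply: eq_big => [s|s s0]; first by rewrite mulf_eq0 (negPf a0) orbF.
  by rewrite scalerA; congr (_ * psi _); rewrite /h; field.
have q1_gt0 : 0 < (q.-1)%:R :> C by rewrite ltr0n -ltnS prednK // finRing_gt1.
have sum_units (A : C) : \sum_(u : F | u != 0) A = (q.-1)%:R * A.
  by rewrite mulr_natl -(cardC1 (0 : F)) -sumr_const.
have sumS : \sum_x `|S (- t) x| ^+ 2 <= q%:R * ((q ^ d)%:R * \sum_x `|f x| ^+ 2).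
  rewrite -plancherel -(ler_pM2l q1_gt0) -[leLHS]sum_units.
  under eq_bigr => a a0 do
    (rewrite (reindex_inj (scale_inj a a0)) /=; under eq_bigr do rewrite Sscale //).
  rewrite exchange_big /=.
  have -> : (q.-1)%:R * (q%:R * \sum_m `|H m| ^+ 2)
      = \sum_x q%:R * \sum_(u | u != 0) `|H (u *: x)| ^+ 2.
    rewrite mulrCA -mulr_sumr exchange_big /=; congr (_ * _).
    rewrite -sum_units; apply: eq_bigr => u u0.
    by rewrite [LHS](reindex_inj (scale_inj u u0)).
  apply: ler_sum => x _.
  have -> : \sum_(u | u != 0) `|H (u *: x)| ^+ 2
      = \sum_u `|(if u != 0 then H (u *: x) else 0)| ^+ 2.
    rewrite [LHS]big_mkcond; apply: eq_bigr => u _.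
    by case: ifP => //; rewrite normr0 expr0n.
  rewrite -plancherel1 [leRHS](reindex_inj h_inj) /=.
  rewrite [leRHS](bigD1 0) //= -[leLHS]add0r lerD ?exprn_ge0 ?normr_ge0 //.
  rewrite le_eqVlt; apply/orP; left; apply/eqP; apply: eq_bigr => a _.
  congr (`|_| ^+ 2); rewrite /S [LHS]big_mkcond; apply: eq_bigr => u _.
  by case: ifP; rewrite ?mul0r.
under eq_bigr do rewrite BE normrM exprMn.
rewrite -mulr_sumr normrV ?unitfE ?(lt0r_neq0 qC) // normr_nat.
have -> : (q ^ d.-1)%:R = q%:R ^- 2 * (q%:R * (q ^ d)%:R) :> C.
  by rewrite !natrX -{2}(prednK d_gt0) (exprS _ d.-1); field; exact: lt0r_neq0.
by rewrite exprVn -!mulrA ler_pM2l ?invr_gt0 ?exprn_gt0.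
Qed.

End Fourier.

(** * Closed walks in nearly constant matrices *)

Section Euclidean.

Variable R : rcfType.

Definition dot m (a b : 'cV[R]_m) : R := \sum_i a i 0 * b i 0.
Definition nrm m (a : 'cV[R]_m) : R := Num.sqrt (dot a a).

Lemma dotDr m (a b c : 'cV[R]_m) : dot a (b + c) = dot a b + dot a c.
Proof. by rewrite -big_split; apply: eq_bigr => i _; rewrite mxE mulrDr. Qed.

Lemma dotZr m k (a b : 'cV[R]_m) : dot a (k *: b) = k * dot a b.
Proof. by rewrite mulr_sumr; apply: eq_bigr => i _; rewrite mxE mulrCA. Qed.

Lemma dotC m (a b : 'cV[R]_m) : dot a b = dot b a.
Proof. by apply: eq_bigr => i _; rewrite mulrC. Qed.

Lemma dot_ge0 m (a : 'cV[R]_m) : 0 <= dot a a.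
Proof. by apply: sumr_ge0 => i _; rewrite -expr2 sqr_ge0. Qed.

Lemma nrm_ge0 m (a : 'cV[R]_m) : 0 <= nrm a. Proof. exact: sqrtr_ge0. Qed.

Lemma nrm0 m : nrm (0 : 'cV[R]_m) = 0.
Proof. by rewrite /nrm /dot big1 ?sqrtr0 // => i _; rewrite mxE mul0r. Qed.

Lemma sqr_nrm m (a : 'cV[R]_m) : nrm a ^+ 2 = dot a a.
Proof. by rewrite sqr_sqrtr ?dot_ge0. Qed.

Lemma cauchy_schwarz m (a b : 'cV[R]_m) : `|dot a b| <= nrm a * nrm b.
Proof.
rewrite -sqrtr_sqr -sqrtrM ?dot_ge0 // ler_wsqrtr // -subr_ge0.
(* Lagrange's identity. *)
have : 0 <= \sum_i \sum_j (a i 0 * b j 0 - a j 0 * b i 0) ^+ 2.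
  by apply: sumr_ge0 => i _; apply: sumr_ge0 => j _; rewrite sqr_ge0.
have -> : \sum_i \sum_j (a i 0 * b j 0 - a j 0 * b i 0) ^+ 2 =
    2 * (dot a a * dot b b - dot a b ^+ 2).
  have prodE (x y z w : 'cV[R]_m) :
      dot x y * dot z w = \sum_i \sum_j (x i 0 * y i 0) * (z j 0 * w j 0).
    by rewrite /dot mulr_suml; apply: eq_bigr => i _; rewrite mulr_sumr.
  have -> : 2 * (dot a a * dot b b - dot a b ^+ 2) =
      dot a a * dot b b + dot b b * dot a a - 2 * (dot a b * dot a b) by ring.
  rewrite !prodE mulr_sumr -big_split -sumrB /=; apply: eq_bigr => i _.
  rewrite mulr_sumr -big_split -sumrB /=; apply: eq_bigr => j _; ring.
by rewrite pmulr_rge0 // ltr0n.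
Qed.

Lemma nrmD m (a b : 'cV[R]_m) : nrm (a + b) <= nrm a + nrm b.
Proof.
rewrite -(@ler_pXn2r _ 2) ?nnegrE ?addr_ge0 ?nrm_ge0 // sqrrD !sqr_nrm.
rewrite dotDr [dot (a + b) a]dotC [dot (a + b) b]dotC !dotDr.
have := le_trans (ler_norm _) (cauchy_schwarz a b).
rewrite [dot b a]dotC -mulr_natl; move: (dot _ _) (dot _ _) (dot _ _) (_ * _).
by move=> x y z w le; lra.
Qed.

Lemma nrmZ m k (a : 'cV[R]_m) : nrm (k *: a) = `|k| * nrm a.
Proof.
rewrite /nrm dotZr dotC dotZr mulrA -expr2 sqrtrM ?sqr_ge0 //.
by rewrite sqrtr_sqr.
Qed.

Definition opbound m (X : 'M[R]_m) (c : R) := forall v, nrm (X *m v) <= c * nrm v.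

Lemma opboundD m (X Y : 'M[R]_m) c k :
  opbound X c -> opbound Y k -> opbound (X + Y) (c + k).
Proof.
move=> Xc Yk v; rewrite mulmxDl mulrDl.
exact: le_trans (nrmD _ _) (lerD (Xc v) (Yk v)).
Qed.

Lemma opboundX m (X : 'M[R]_m.+1) c k : 0 <= c -> opbound X c -> opbound (X ^+ k) (c ^+ k).
Proof.
move=> c0 Xc; elim: k => [|k IHk] v; first by rewrite mul1mx mul1r.
rewrite !exprS -[(X * _) *m v]mulmxA; apply: le_trans (Xc _) _.
by rewrite -mulrA ler_wpM2l.
Qed.

End Euclidean.

Section ClosedWalks.

Variables (R : rcfType) (m : nat) (M : 'M[R]_m.+1) (delta lam : R).

Let N : R := m.+1%:R.
Let u : 'cV[R]_m.+1 := const_mx 1.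
Let J : 'M[R]_m.+1 := const_mx delta.
Let B := M - J.
Let L := delta * N.

Hypotheses (symM : M^T = M) (M01 : forall i j, M i j ^+ 2 = M i j).
Hypotheses (delta_gt0 : 0 < delta) (delta_le : delta <= 1 / 2).
Hypotheses (lam_ge0 : 0 <= lam) (boundB : opbound B lam).

Let L_ge0 : 0 <= L. Proof. by rewrite mulr_ge0 ?ler0n ?ltW. Qed.

Let dot_u v : dot u v = \sum_i v i 0.
Proof. by apply: eq_bigr => i _; rewrite mxE mul1r. Qed.

Let sqr_nrm_u : nrm u ^+ 2 = N.
Proof.
rewrite sqr_nrm dot_u; under eq_bigr do rewrite mxE.
by rewrite sumr_const card_ord.
Qed.

Let J_E : J = delta *: (u *m u^T).
Proof. by apply/matrixP => i j; rewrite !mxE big_ord1 !mxE !mulr1. Qed.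

Let J_mul v : J *m v = (delta * dot u v) *: u.
Proof.
apply/colP => i; rewrite !mxE mulr1 dot_u mulr_sumr.
by apply: eq_bigr => j _; rewrite mxE.
Qed.

Let boundJ : opbound J L.
Proof.
move=> v; rewrite J_mul nrmZ normrM ger0_norm ?(ltW delta_gt0) // /L -sqr_nrm_u.
rewrite -!mulrA; apply: ler_wpM2l; first exact: ltW.
rewrite mulrC; apply: ler_wpM2l; first exact: nrm_ge0.
exact: cauchy_schwarz.
Qed.

Let ME : M = J + B. Proof. by rewrite addrC subrK. Qed.

Let boundM : opbound M (L + lam).
Proof. by rewrite ME; apply: opboundD. Qed.

Let Llam_ge0 : 0 <= L + lam. Proof. exact: addr_ge0. Qed.

(** Since J u = L u, one more factor M multiplies the error by at most L + lam and adds lam L^k |u|,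
    which is the recursion of (L + lam)^k - L^k. *)
Let Mu_near k : nrm (M ^+ k *m u - L ^+ k *: u) <= ((L + lam) ^+ k - L ^+ k) * nrm u.
Proof.
elim: k => [|k IHk].
  by rewrite mul1mx scale1r subrr !expr0 subrr mul0r nrm0.
have Mu : M *m u = L *: u + B *m u.
  by rewrite {1}ME mulmxDl J_mul -sqr_nrm sqr_nrm_u.
have -> : M ^+ k.+1 *m u - L ^+ k.+1 *: u =
    M *m (M ^+ k *m u - L ^+ k *: u) + L ^+ k *: (B *m u).
  rewrite exprS -[(M * _) *m u]mulmxA mulmxBr -scalemxAr Mu scalerDr scalerA -exprSr.
  by rewrite opprD addrA subrK.
apply: le_trans (nrmD _ _) _; rewrite nrmZ ger0_norm ?exprn_ge0 //.
apply: le_trans (lerD (boundM _) (ler_wpM2l (exprn_ge0 k L_ge0) (boundB u))) _.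
apply: le_trans (lerD (ler_wpM2l Llam_ge0 IHk) (lexx _)) _.
by rewrite le_eqVlt; apply/orP; left; apply/eqP; rewrite !exprS; ring.
Qed.

Let trace_word j k : \tr (M ^+ k *m J *m B ^+ j) =
  delta * dot u (B ^+ j *m (M ^+ k *m u)).
Proof.
rewrite J_E -scalemxAr -scalemxAl mxtraceZ; congr (_ * _).
rewrite [M ^+ k *m (_ *m _)]mulmxA -(mulmxA _ u^T) mxtrace_mulC -mulmxA.
by rewrite /mxtrace big_ord1 mxE; apply: eq_bigr => i _; rewrite mxE.
Qed.

Let telescope n : M ^+ n - B ^+ n =
  \sum_(k < n) M ^+ k *m J *m B ^+ (n.-1 - k).
Proof.
elim: n => [|n IHn]; first by rewrite big_ord0 subrr.
rewrite big_ord_recl /= subn0 mul1mx.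
have -> : M ^+ n.+1 - B ^+ n.+1 = J * B ^+ n + M * (M ^+ n - B ^+ n).
  have -> : M * (M ^+ n - B ^+ n) = M ^+ n.+1 - (J * B ^+ n + B ^+ n.+1).
    by rewrite mulrBr -exprS {2}ME mulrDl -exprS.
  by rewrite [RHS]addrC opprD addrA addrAC subrK.
rewrite IHn mulr_sumr; congr (_ + _); apply: eq_bigr => k _.
rewrite /bump /= add1n exprS -!mulmxE !mulmxA; congr (_ *m _ ^+ _).
have := ltn_ord k; lia.
Qed.

Let dot_delta b c : nrm b <= c * nrm u -> `|delta * dot u b| <= L * c.
Proof.
move=> le_b; rewrite normrM (ger0_norm (ltW delta_gt0)) /L -mulrA.
apply: ler_wpM2l; first exact: ltW.
apply: le_trans (cauchy_schwarz _ _) _; rewrite -sqr_nrm_u expr2 -mulrA.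
by apply: ler_wpM2l; [exact: nrm_ge0 | rewrite mulrC].
Qed.

(** The word M^n J supplies the main term by [Mu_near]. The other words M^k J B^(n - k) form a
    geometric sum equal to lam ((L + lam)^n - lam^n) after bounding. *)
Let trace_near n :
  `|\tr (M ^+ n.+1) - \tr (B ^+ n.+1) - L ^+ n.+1| <= (L + lam) ^+ n.+1 - L ^+ n.+1.
Proof.
rewrite -raddfB telescope raddf_sum /=; under eq_bigr do rewrite trace_word.
rewrite big_ord_recr /= subnn mul1mx -addrA.
have -> : delta * dot u (M ^+ n *m u) - L ^+ n.+1
    = delta * dot u (M ^+ n *m u - L ^+ n *: u).
  rewrite -scaleN1r scalerA dotDr dotZr -sqr_nrm sqr_nrm_u mulrDr exprS /L; ring.
apply: le_trans (ler_normD _ _) _.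
apply: le_trans (lerD (ler_norm_sum _ _ _) (dot_delta (Mu_near n))) _.
have word_le (k : 'I_n) : `|delta * dot u (B ^+ (n - k) *m (M ^+ k *m u))|
    <= L * (lam ^+ (n - k) * (L + lam) ^+ k).
  apply: dot_delta; rewrite -mulrA; apply: le_trans (opboundX _ lam_ge0 boundB _) _.
  by apply: ler_wpM2l; [exact: exprn_ge0 | exact: opboundX].
apply: le_trans (lerD (ler_sum _ (fun k _ => word_le k)) (lexx _)) _.
rewrite -mulr_sumr.
have -> : L * (\sum_(k < n) lam ^+ (n - k) * (L + lam) ^+ k)
    = lam * ((L + lam) ^+ n - lam ^+ n).
  rewrite -[(L + lam) ^+ n - _]opprB (subrXX lam (L + lam) n).
  have -> : lam - (L + lam) = - L by ring.
  rewrite mulNr opprK mulrCA; congr (_ * _); rewrite mulr_sumr.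
  apply: eq_bigr => k _; rewrite mulrA -exprS; congr (_ ^+ _ * _).
  by have := ltn_ord k; lia.
have := exprn_ge0 n.+1 lam_ge0; rewrite !exprS; nra.
Qed.

Let symB : B^T = B.
Proof. by rewrite /B raddfB /= symM; congr (_ - _); apply/matrixP => i j; rewrite !mxE. Qed.

Let Bsym i j : B i j = B j i. Proof. by rewrite -{1}symB mxE. Qed.

Let dot_sum := \sum_i \sum_j B i j ^+ 2.

(** As B is symmetric, the trace is the sum over the columns b of B of the products of b with B^n
    b. *)
Let trace_B_le n : `|\tr (B ^+ n.+2)| <= lam ^+ n * dot_sum.
Proof.
have -> : \tr (B ^+ n.+2) = \sum_i dot (col i B) (B ^+ n *m col i B).
  rewrite exprS exprSr; apply: eq_bigr => i _; rewrite mxE; apply: eq_bigr => j _.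
  rewrite Bsym [col i B j 0]mxE -mulmxE; congr (_ * _); rewrite !mxE.
  by apply: eq_bigr => k _; rewrite !mxE.
apply: le_trans (ler_norm_sum _ _ _) _; rewrite mulr_sumr; apply: ler_sum => i _.
apply: le_trans (cauchy_schwarz _ _) _.
have -> : \sum_j B i j ^+ 2 = nrm (col i B) ^+ 2.
  rewrite sqr_nrm; apply: eq_bigr => j _.
  by rewrite [col i B j 0]mxE Bsym expr2.
rewrite expr2 mulrCA; apply: ler_wpM2l; first exact: nrm_ge0.
exact: opboundX.
Qed.

(** Entries 0 and 1 give (M - delta)^2 = (1 - 2 delta) M + delta^2 entrywise; [delta_le] makes the
    first coefficient nonnegative, so an upper bound for the sum [e] of all entries of M
    suffices. *)
Let dot_sum_le : dot_sum <= N * (L + lam).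
Proof.
pose e := \sum_i \sum_j M i j.
have eE : e = delta * N ^+ 2 + dot u (B *m u).
  have -> : e = dot u (M *m u).
    rewrite dot_u; apply: eq_bigr => i _; rewrite mxE; apply: eq_bigr => j _.
    by rewrite mxE mulr1.
  by rewrite {1}ME mulmxDl dotDr J_mul dotZr -sqr_nrm sqr_nrm_u; ring.
have leB : dot u (B *m u) <= lam * N.
  apply: le_trans (ler_norm _) _; apply: le_trans (cauchy_schwarz _ _) _.
  rewrite -sqr_nrm_u expr2 mulrCA; apply: ler_wpM2l; first exact: nrm_ge0.
  exact: boundB.
have -> : dot_sum = (1 - 2 * delta) * e + delta ^+ 2 * N ^+ 2.
  transitivity (\sum_(i < m.+1) \sum_(j < m.+1) ((1 - 2 * delta) * M i j + delta ^+ 2)).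
    apply: eq_bigr => i _; apply: eq_bigr => j _; rewrite !mxE sqrrB M01; ring.
  under eq_bigr do rewrite big_split /= -mulr_sumr sumr_const card_ord.
  rewrite big_split /= -mulr_sumr sumr_const card_ord -/e; congr (_ + _).
  by rewrite -mulrnA -mulr_natr natrM -expr2.
have N_ge0 : 0 <= N by exact: ler0n.
have d1 : 0 <= 1 - 2 * delta by have := delta_le; lra.
have e_le : e <= N * (L + lam) by rewrite eE /L; nra.
apply: le_trans (lerD (ler_wpM2l d1 e_le) (lexx _)) _.
have dN : 0 <= delta * N * lam by rewrite mulr_ge0.
have dN2 : 0 <= delta ^+ 2 * N ^+ 2 by rewrite mulr_ge0 ?sqr_ge0.
by rewrite /L; nra.
Qed.

Theorem trace_closed_walks n :
  `|\tr (M ^+ n.+2) - L ^+ n.+2| <=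
    (L + lam) ^+ n.+2 - L ^+ n.+2 + lam ^+ n * (N * (L + lam)).
Proof.
have -> : \tr (M ^+ n.+2) - L ^+ n.+2 =
    (\tr (M ^+ n.+2) - \tr (B ^+ n.+2) - L ^+ n.+2) + \tr (B ^+ n.+2) by ring.
apply: le_trans (ler_normD _ _) _; apply: lerD; first exact: trace_near.
apply: le_trans (trace_B_le n) _; apply: ler_wpM2l; first exact: exprn_ge0.
exact: dot_sum_le.
Qed.

End ClosedWalks.

(** * Traces of powers as numbers of closed walks *)

Section CountWalks.

Variables (R : pzRingType) (m : nat) (r : rel 'I_m.+1).

Let M : 'M[R]_m.+1 := \matrix_(i, j) (r i j)%:R.

Lemma mx_pow_count_paths n i j : (M ^+ n.+1) i j =
  (\sum_(t : n.-tuple 'I_m.+1) path r i (rcons t j))%:R.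
Proof.
elim: n i => [|n IHn] i.
  rewrite expr1 mxE (big_pred1 [tuple]) => [|t]; first by rewrite /= andbT.
  by symmetry; apply/eqP; apply: tuple0.
rewrite exprS !mxE.
rewrite (reindex (fun p : 'I_m.+1 * n.-tuple 'I_m.+1 => [tuple of p.1 :: p.2])) /=; last first.
  exists (fun t : n.+1.-tuple 'I_m.+1 => (thead t, [tuple of behead t])) => [[k t] _|t _] /=.
    by congr (_, _); apply: val_inj.
  by rewrite -tuple_eta.
rewrite -(pair_big xpredT xpredT (fun k (t : n.-tuple 'I_m.+1) =>
    (r i k && path r k (rcons t j) : nat))) /= natr_sum.
apply: eq_bigr => k _; rewrite IHn mxE.
case: (r i k); rewrite ?mul1r // mul0r big1 //.
Qed.

Lemma trace_count_cycles n : (0 < n)%N ->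
  \tr (M ^+ n) = #|[set c : n.-tuple 'I_m.+1 | cycle r c]|%:R.
Proof.
case: n => // n _; rewrite /mxtrace; under eq_bigr do rewrite mx_pow_count_paths.
rewrite -natr_sum pair_big /= -sum1_card; congr (_%:R).
rewrite [RHS]big_mkcond /=.
rewrite [RHS](reindex (fun p : 'I_m.+1 * n.-tuple 'I_m.+1 => [tuple of p.1 :: p.2])) /=; last first.
  exists (fun t : n.+1.-tuple 'I_m.+1 => (thead t, [tuple of behead t])) => [[k t] _|t _] /=.
    by congr (_, _); apply: val_inj.
  by rewrite -tuple_eta.
by apply: eq_bigr => -[i t] _; rewrite inE /=; case: (path _ _ _).
Qed.

End CountWalks.

Section CyclesInSet.

Variables (R : rcfType) (F : finFieldType) (d : nat) (e : rel 'rV[F]_d).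
Variables (E : {set 'rV[F]_d}) (delta lam : R).
Local Notation V := 'rV[F]_d.
Local Notation N := (#|E|%:R : R).

Hypotheses (symE : symmetric e) (E_gt0 : (0 < #|E|)%N).
Hypotheses (delta_gt0 : 0 < delta) (delta_le : delta <= 1 / 2) (lam_ge0 : 0 <= lam).
Hypothesis operator_bound : forall f : V -> R,
  \sum_x (\sum_y ((e x y)%:R - delta) * f y) ^+ 2 <= lam ^+ 2 * \sum_x f x ^+ 2.

Let m := #|E|.-1.
Let cardE : #|E| = m.+1. Proof. by rewrite /m prednK. Qed.
Let ev (i : 'I_m.+1) : V := enum_val (cast_ord (esym cardE) i).
Let ev_inj : injective ev.
Proof. by move=> i j /enum_val_inj/cast_ord_inj. Qed.
Let ev_in i : ev i \in E. Proof. exact: enum_valP. Qed.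
Let r : rel 'I_m.+1 := relpre ev e.
Let M : 'M[R]_m.+1 := \matrix_(i, j) (r i j)%:R.

Let inv_ev x : 'I_m.+1 := odflt ord0 [pick i | ev i == x].
Let inv_evK x : x \in E -> ev (inv_ev x) = x.
Proof.
move=> xE; rewrite /inv_ev; case: pickP => [i /eqP//|none].
have := none (cast_ord cardE (enum_rank_in xE x)).
by rewrite /ev cast_ordK enum_rankK_in ?eqxx.
Qed.
Let evK i : inv_ev (ev i) = i. Proof. by apply: ev_inj; rewrite inv_evK. Qed.

Lemma num_cycles_tuples n :
  num_cycles e E n = #|[set c : n.-tuple 'I_m.+1 | cycle r c]|.
Proof.
have map_inj : injective (fun c : n.-tuple 'I_m.+1 => [tuple of map ev c]).
  move=> c1 c2 /(congr1 val) /= /inj_map E12; apply: val_inj; exact: E12 ev_inj.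
rewrite -(card_imset _ map_inj); apply: eq_card => c; rewrite inE.
apply/andP/imsetP => [[cE cc]|[c' + ->]]; last first.
  rewrite inE -cycle_map => ->; split=> //.
  by apply/allP => _ /mapP[i _ ->]; apply: ev_in.
have mapK : map ev (map inv_ev c) = c.
  rewrite -map_comp; apply: map_id_in => x xc /=.
  by rewrite inv_evK //; apply: (allP cE).
exists [tuple of map inv_ev c]; last by apply: val_inj; rewrite /= mapK.
by rewrite inE -cycle_map mapK.
Qed.

Lemma sum_ev (G : V -> R) : \sum_(x in E) G x = \sum_i G (ev i).
Proof.
rewrite (reindex ev) /=; first by apply: eq_bigl => i; rewrite ev_in.
by exists inv_ev => [i _|x xE]; rewrite ?evK ?inv_evK.
Qed.

(** Extend v by zero outside E and discard the values of the image outside E. *)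
Lemma restricted_operator_bound : opbound (M - const_mx delta) lam.
Proof.
move=> v; pose f x := if x \in E then v (inv_ev x) 0 else 0.
have fE (G : V -> R) : \sum_y G y * f y = \sum_i G (ev i) * v i 0.
  rewrite -(eq_bigr _ (fun i _ => congr1 (fun j => G (ev i) * v j 0) (evK i))).
  rewrite -(sum_ev (fun y => G y * v (inv_ev y) 0)) [RHS]big_mkcond.
  by apply: eq_bigr => y _; rewrite /f; case: ifP; rewrite ?mulr0.
have f2 : \sum_x f x ^+ 2 = dot v v.
  transitivity (\sum_x f x * f x); first by apply: eq_bigr => x _; rewrite expr2.
  by rewrite fE; apply: eq_bigr => i _; rewrite /f ev_in evK.
have := operator_bound f; rewrite f2 => le_f.
rewrite -(@ler_pXn2r _ 2) ?nnegrE ?nrm_ge0 ?mulr_ge0 ?nrm_ge0 // exprMn !sqr_nrm.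
apply: le_trans le_f; rewrite [leRHS](bigID (mem E)) /= -[leLHS]addr0.
apply: lerD; last by apply: sumr_ge0 => x _; rewrite sqr_ge0.
rewrite (sum_ev (fun x => (\sum_y ((e x y)%:R - delta) * f y) ^+ 2)).
rewrite le_eqVlt; apply/orP; left; apply/eqP; apply: eq_bigr => i _.
rewrite -expr2 mxE fE; congr (_ ^+ 2); apply: eq_bigr => j _.
by rewrite !mxE.
Qed.

Theorem num_cycles_bound n :
  `|(num_cycles e E n.+2)%:R - (delta * N) ^+ n.+2| <=
  (delta * N + lam) ^+ n.+2 - (delta * N) ^+ n.+2 + lam ^+ n * (N * (delta * N + lam)).
Proof.
rewrite num_cycles_tuples -trace_count_cycles // cardE.
apply: trace_closed_walks => //; last exact: restricted_operator_bound.
  by apply/matrixP => i j; rewrite !mxE /r /= symE.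
by move=> i j; rewrite mxE; case: (r i j); rewrite ?expr1n ?expr0n.
Qed.

End CyclesInSet.

(** * The estimates *)

Section ComplexNumbers.

Local Open Scope complex_scope.

Lemma complex_archimedean (R : realType) (x : R[i]) : 0 <= x -> exists n, x <= n%:R.
Proof.
case: x => a b; rewrite lecE /= => /andP[/eqP b0 a0].
exists (Num.bound a); rewrite -[_%:R](rmorph_nat (real_complex R)) lecE /= -b0 eqxx /=.
by rewrite ltW // archi_boundP.
Qed.

Lemma complex_normsq (R : rcfType) (x : R) : `|x%:C| ^+ 2 = (x ^+ 2)%:C.
Proof. by rewrite real_normK ?rmorphXn // complex_real. Qed.

End ComplexNumbers.

Section RealOperators.

Local Open Scope complex_scope.

Variables (R : realType) (F : finFieldType) (d : nat) (t : F).
Hypotheses (d_gt0 : (0 < d)%N) (t0 : t != 0).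
Local Notation V := 'rV[F]_d.
Local Notation q := (#|F|%:R : R).

Lemma real_operator_bound (e : rel V) k :
    (forall f : V -> R[i],
      \sum_x `|\sum_y ((e x y)%:R - #|F|%:R^-1) * f y| ^+ 2 <= k%:R * \sum_x `|f x| ^+ 2) ->
  forall f : V -> R,
    \sum_x (\sum_y ((e x y)%:R - q^-1) * f y) ^+ 2 <= k%:R * \sum_x f x ^+ 2.
Proof.
move=> bound f; have := bound (fun y => (f y)%:C).
have sumC (G : V -> R) : \sum_x (G x)%:C = (\sum_x G x)%:C by rewrite rmorph_sum.
have inner x : \sum_y ((e x y)%:R - #|F|%:R^-1) * (f y)%:C
    = (\sum_y ((e x y)%:R - q^-1) * f y)%:C.
  rewrite -sumC; apply: eq_bigr => y _.
  by rewrite rmorphM rmorphB fmorphV !rmorph_nat.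
under eq_bigr do rewrite inner complex_normsq.
under [X in _ <= _ * X -> _]eq_bigr do rewrite complex_normsq.
by rewrite !sumC -[k%:R](rmorph_nat (real_complex R)) -rmorphM lecR.
Qed.

Lemma dist_operator_bound_real (f : V -> R) : odd #|F| ->
  \sum_x (\sum_y ((dist_adj t x y)%:R - q^-1) * f y) ^+ 2 <=
    (4 * #|F| ^ d.-1)%:R * \sum_x f x ^+ 2.
Proof.
move=> oddF; apply: real_operator_bound => {}f.
have [psi psiP] := exists_additive_character F R[i].
exact: (distance_operator_bound psiP oddF d_gt0 (@complex_archimedean R) t0).
Qed.

Lemma prod_operator_bound_real (f : V -> R) :
  \sum_x (\sum_y ((prod_adj t x y)%:R - q^-1) * f y) ^+ 2 <=
    (4 * #|F| ^ d.-1)%:R * \sum_x f x ^+ 2.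
Proof.
apply: (le_trans (real_operator_bound (k := #|F| ^ d.-1) _ _)) => [{}f|].
  have [psi psiP] := exists_additive_character F R[i].
  exact: (product_operator_bound psiP).
apply: ler_wpM2r; first by apply: sumr_ge0 => x _; rewrite sqr_ge0.
by rewrite ler_nat leq_pmull.
Qed.

End RealOperators.

Section Numerics.

Variable R : realType.

(** In the induction, (1 + 2 a)(1 + x) <= 1 + 2 (a + x) as long as a = n x is at most 1 / 2. *)
Lemma expr1D_le (x : R) n : 0 <= x -> n%:R * x <= 1 / 2 ->
  (1 + x) ^+ n <= 1 + 2 * (n%:R * x).
Proof.
move=> x0; elim: n => [|n IHn]; first by rewrite expr0 mul0r mulr0 addr0.
have -> : n.+1%:R * x = n%:R * x + x by rewrite -addn1 natrD mulrDl mul1r.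
move=> le; have nx0 : 0 <= n%:R * x by rewrite mulr_ge0 ?ler0n.
have IH : (1 + x) ^+ n <= 1 + 2 * (n%:R * x) by apply: IHn; lra.
have x1 : 0 <= 1 + x by rewrite addr_ge0.
rewrite exprSr; apply: le_trans (ler_wpM2r x1 IH) _.
have : 0 <= (1 / 2 - n%:R * x) * x by rewrite mulr_ge0 // subr_ge0; lra.
by move: (n%:R * x) => a; nra.
Qed.

(** With X = q^((d+1)/2) / N one has lam = 2 X L and N = q L, so the relative error is (1 + 2X)^k -
    1 + (2X)^(k-2) q (1 + 2X). The first part is at most 4 k X. In the second, 8 q X^2 <= 1 is spent
    fully for k >= 6, through its square root for k = 5, and not at all for k = 4, which leaves 8
    X^2, 8 sqrt q X^2 and 8 q X^2. *)
Lemma walk_estimates (q N lam : R) (d n : nat) (C : nat -> nat) :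
    lam = 2 * (q `^ ((d%:R + 1) / 2) / q) -> 2 <= q -> 0 < N -> (4 <= n)%N ->
    cycle_hypothesis q N d n ->
    (forall k,
      `|(C k.+2)%:R - (q^-1 * N) ^+ k.+2| <=
        (q^-1 * N + lam) ^+ k.+2 - (q^-1 * N) ^+ k.+2
        + lam ^+ k * (N * (q^-1 * N + lam))) ->
  cycle_estimates q N d n C.
Proof.
move=> -> q2 N0 n4 hyp walks.
have n48 : (48 <= 24 + 12 * n./2)%N by move: n4; clear; lia.
(* The bound with [n.+1] covers the estimate for length 5 when n = 4. *)
have n6n : (6 * n.+1 <= 24 + 12 * n./2)%N by clear; lia.
have n4n : (4 * n <= 24 + 12 * n./2)%N by clear; lia.
have q0 : 0 < q by apply: lt_le_trans q2.
have qn0 := lt0r_neq0 q0; have Nn0 := lt0r_neq0 N0.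
set P := q `^ ((d%:R + 1) / 2) in hyp walks.
pose X := P / N; pose L := q^-1 * N.
have P0 : 0 < P by rewrite powR_gt0.
have X0 : 0 < X by rewrite divr_gt0.
have X2 : X ^+ 2 = q ^+ (d + 1) / N ^+ 2.
  rewrite exprMn exprVn; congr (_ / _).
  rewrite -(powR_mulrn 2 (ltW P0)) /P -powRrM divfK ?pnatr_eq0 //.
  by rewrite natr1 addn1 powR_mulrn // ltW.
have qX2 : q ^+ (d + 2) / N ^+ 2 = q * X ^+ 2 by rewrite X2 mulrA -exprS addnS.
have g0 : 0 <= 12 * q `^ gamma_exponent R d by rewrite mulr_ge0 ?ler0n ?powR_ge0.
have L0 : 0 < L by rewrite mulr_gt0 ?invr_gt0.
have NE k : N ^+ k / q ^+ k = L ^+ k by rewrite /L exprMn exprVn mulrC.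
have walk k : `|(C k.+2)%:R - L ^+ k.+2| <=
    L ^+ k.+2 * ((1 + 2 * X) ^+ k.+2 - 1 + (2 * X) ^+ k * (q * (1 + 2 * X))).
  apply: le_trans (walks k) _; rewrite le_eqVlt; apply/orP; left; apply/eqP.
  have -> : 2 * (P / q) = L * (2 * X) by rewrite /L /X; field; rewrite qn0 Nn0.
  have -> : N = q * L by rewrite /L; field.
  have -> : q^-1 * (q * L) = L by field.
  have -> : L + L * (2 * X) = L * (1 + 2 * X) by ring.
  have alg (l x : R) : (l * (1 + 2 * x)) ^+ k.+2 - l ^+ k.+2
      + (l * (2 * x)) ^+ k * (q * l * (l * (1 + 2 * x)))
    = l ^+ k.+2 * ((1 + 2 * x) ^+ k.+2 - 1 + (2 * x) ^+ k * (q * (1 + 2 * x))).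
    by rewrite !exprMn !exprS; ring.
  exact: alg.
move: hyp; rewrite /cycle_hypothesis qX2 -/X => hyp.
have h8 : 8 * (q * X ^+ 2) <= 1.
  have : 0 <= (24 + 12 * n./2)%:R * X by rewrite mulr_ge0 ?ler0n ?ltW.
  lra.
have qX0 : 0 <= q * X ^+ 2 by rewrite mulr_ge0 ?exprn_ge0 ?ltW.
have hX : (24 + 12 * n./2)%:R * X <= 1 by lra.
have X48 : 48 * X <= 1.
  apply: le_trans hX; apply: ler_wpM2r; first exact: ltW.
  by rewrite ler_nat.
have small k : (4 <= k <= 5)%N || (k == n) ->
    (1 + 2 * X) ^+ k - 1 <= 4 * k%:R * X.
  move=> hk; have kX : k%:R * (2 * X) <= 1 / 2.
    apply: le_trans (_ : n.+1%:R * (2 * X) <= _).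
      apply: ler_wpM2r; first lra.
      by rewrite ler_nat; move: hk n4; clear; lia.
    have : (6 * n.+1)%:R * X <= 1.
      by apply: le_trans hX; apply: ler_wpM2r; [exact: ltW | rewrite ler_nat].
    by rewrite natrM; lra.
  have X20 : 0 <= 2 * X by lra.
  by have := expr1D_le X20 kX; rewrite [4 * _]mulrC; lra.
have estimate k A : (4 <= k <= 5)%N || (k == n) ->
    (2 * X) ^+ k.-2 * (q * (1 + 2 * X)) + 4 * k%:R * X <= A ->
    `|(C k)%:R - N ^+ k / q ^+ k| <= N ^+ k / q ^+ k * (12 * q `^ gamma_exponent R d + A).
  move=> hk le_A; rewrite NE; have [j kE] : exists j, k = j.+2.
    by exists k.-2; move: hk n4; clear; lia.
  move: (small k hk) le_A; rewrite kE /= => small_k le_A.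
  apply: le_trans (walk j) _; apply: ler_wpM2l; first by rewrite exprn_ge0 // ltW.
  lra.
rewrite /cycle_estimates; split.
- move=> n6; rewrite -addrA; apply: estimate; first by rewrite eqxx orbT.
  rewrite -X2; apply: lerD; last first.
    apply: ler_wpM2r; first exact: ltW.
    by rewrite -natrM ler_nat.
  apply: le_trans (_ : (2 * X) ^+ 4 * (q * (1 + 2 * X)) <= _).
    apply: ler_wpM2r; first by apply: mulr_ge0; lra.
    by apply: ler_wiXn2l; [lra | lra | move: n6; clear; lia].
  have -> : (2 * X) ^+ 4 * (q * (1 + 2 * X)) 
      = 2 * X ^+ 2 * (1 + 2 * X) * (8 * (q * X ^+ 2)) by ring.
  have c0 : 0 <= 2 * X ^+ 2 * (1 + 2 * X) by apply: mulr_ge0; have := sqr_ge0 X; lra.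
  apply: le_trans (ler_wpM2l c0 h8) _.
  rewrite mulr1 -[leRHS]mulrC; apply: le_trans (_ : X ^+ 2 * (2 * (1 + 2 * X)) <= _).
    by rewrite le_eqVlt; apply/orP; left; apply/eqP; ring.
  by apply: ler_wpM2l; [exact: sqr_ge0 | lra].
- rewrite -addrA; apply: estimate => //.
  rewrite qX2 /=; apply: lerD; last by apply: ler_wpM2r; [exact: ltW | rewrite -natrM ler_nat].
  have -> : (2 * X) ^+ 2 * (q * (1 + 2 * X)) = 4 * (1 + 2 * X) * (q * X ^+ 2) by ring.
  by apply: ler_wpM2r => //; lra.
rewrite -addrA; apply: estimate => //.
pose s := Num.sqrt q; have s0 : 0 < s by rewrite sqrtr_gt0.
have s2 : s ^+ 2 = q by rewrite sqr_sqrtr ?ltW.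
have -> : q `^ ((2 * d%:R + 3) / 2) / N ^+ 2 = s * X ^+ 2.
  have -> : (2 * d%:R + 3) / 2 = 2^-1 + (d + 1)%:R :> R by rewrite natrD; field.
  rewrite powRD ?qn0 ?implybT // powR12_sqrt ?ltW // powR_mulrn ?ltW //.
  by rewrite X2 mulrA.
apply: lerD; last by rewrite /= -/X; apply: ler_wpM2r; [exact: ltW | rewrite -natrM ler_nat].
have sX0 : 0 <= s * X := mulr_ge0 (ltW s0) (ltW X0).
have sX : s * X <= 1 / 2.
  rewrite -(@ler_pXn2r _ 2) ?nnegrE //; last lra.
  by rewrite exprMn s2; lra.
rewrite /= -s2.
have -> : (2 * X) ^+ 3 * (s ^+ 2 * (1 + 2 * X)) = 8 * (s * X ^+ 2) * (s * X * (1 + 2 * X)) by ring.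
rewrite -[leRHS]mulr1; apply: ler_wpM2l.
  by apply: mulr_ge0; [exact: ler0n | apply: mulr_ge0]; [exact: ltW | exact: sqr_ge0].
apply: le_trans (_ : 1 / 2 * (1 + 2 * X) <= _); last lra.
by apply: ler_wpM2r; lra.
Qed.

End Numerics.

Lemma num_cycles_empty (F : finFieldType) d (e : rel 'rV[F]_d) (E : {set 'rV[F]_d}) n :
  #|E| = 0%N -> num_cycles e E n.+1 = 0%N.
Proof.
move/cards0_eq->; apply: eq_card0 => c; rewrite inE; apply/negbTE.
by case/tupleP: c => x c; rewrite /= inE.
Qed.

Lemma cycle_estimates_of_operator (R : realType) (F : finFieldType) (d n : nat)
    (e : rel 'rV[F]_d) (E : {set 'rV[F]_d}) :
  (0 < d)%N -> (4 <= n)%N -> symmetric e ->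
  (forall f : 'rV[F]_d -> R,
    \sum_x (\sum_y ((e x y)%:R - #|F|%:R^-1) * f y) ^+ 2 <=
      (4 * #|F| ^ d.-1)%:R * \sum_x f x ^+ 2) ->
  cycle_hypothesis (#|F|%:R : R) #|E|%:R d n ->
  cycle_estimates (#|F|%:R : R) #|E|%:R d n (num_cycles e E).
Proof.
move=> d_gt0 n4 symE bound hyp; have F_gt1 := finRing_gt1 F.
have q_gt0 : 0 < #|F|%:R :> R by rewrite ltr0n ltnW.
case: (posnP #|E|) => [E0|E_gt0].
  have zero k (A : R) : `|(num_cycles e E k.+1)%:R - #|E|%:R ^+ k.+1 / #|F|%:R ^+ k.+1|
      <= #|E|%:R ^+ k.+1 / #|F|%:R ^+ k.+1 * A.
    by rewrite num_cycles_empty // E0 expr0n !mul0r subrr normr0.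
  by split=> [n6||]; [case: (n) n4 => // k _ | |]; apply: zero.
pose lam : R := 2 * (#|F|%:R `^ ((d%:R + 1) / 2) / #|F|%:R).
apply: (walk_estimates (lam := lam)) => //; rewrite ?ltr0n ?ler_nat // => k.
apply: num_cycles_bound => //.
- by rewrite invr_gt0.
- by rewrite mul1r lef_pV2 ?posrE // (ler_nat R 2).
- by rewrite mulr_ge0 ?ler0n ?divr_ge0 ?powR_ge0.
move=> f; apply: le_trans (bound f) _.
rewrite le_eqVlt; apply/orP; left; apply/eqP; congr (_ * _).
rewrite /lam exprMn exprMn exprVn -(powR_mulrn 2 (powR_ge0 _ _)) -powRrM divfK ?pnatr_eq0 //.
rewrite natr1 powR_mulrn ?ler0n // -{2}(prednK d_gt0) !exprS natrM natrX.
by field; exact: lt0r_neq0.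
Qed.

Lemma dist_adj_sym (F : finFieldType) d (t : F) : symmetric (@dist_adj F d t).
Proof.
move=> x y; rewrite /dist_adj; congr (_ == _); apply: eq_bigr => i _.
by rewrite !mxE -sqrrN opprB.
Qed.

Lemma prod_adj_sym (F : finFieldType) d (t : F) : symmetric (@prod_adj F d t).
Proof.
by move=> x y; congr (_ == _); apply: eq_bigr => i _; rewrite mulrC.
Qed.

Theorem theorem1p1 (R : realType) (F : finFieldType) (d n : nat) (t : F)
    (E : {set 'rV[F]_d}) :
  (2 <= d)%N -> t != 0 -> (4 <= n)%N ->
  cycle_hypothesis (#|F|%:R : R) #|E|%:R d n ->
  (odd #|F| ->
   cycle_estimates (#|F|%:R : R) #|E|%:R d n (num_cycles (dist_adj t) E)) /\
  cycle_estimates (#|F|%:R : R) #|E|%:R d n (num_cycles (prod_adj t) E).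
Proof.
move=> d2 t0 n4 hyp; have d_gt0 := ltnW d2; split=> [oddF|].
  apply: cycle_estimates_of_operator => // [|f]; first exact: dist_adj_sym.
  exact: dist_operator_bound_real.
apply: cycle_estimates_of_operator => // [|f]; first exact: prod_adj_sym.
exact: prod_operator_bound_real.
Qed.
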